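(* Consider the shear shallow water system without source term, and the semi-discrete finite difference scheme $$\frac{d}{dt}\mathbf{U}_{i,j}+\frac{1}{\Delta x}\Big(\hat{\mathbf{F}}^{x,k}_{i+\frac12,j}-\hat{\mathbf{F}}^{x,k}_{i-\frac12,j}\Big)+\frac{1}{\Delta y}\Big(\hat{\mathbf{F}}^{y,k}_{i,j+\frac12}-\hat{\mathbf{F}}^{y,k}_{i,j-\frac12}\Big)+\mathbf{B}^x(\mathbf{U}_{i,j})\Big(\frac{\partial h}{\partial x}\Big)_{i,j}+\mathbf{B}^y(\mathbf{U}_{i,j})\Big(\frac{\partial h}{\partial y}\Big)_{i,j}=0,$$ where the numerical fluxes $\hat{\mathbf{F}}^{x,k},\hat{\mathbf{F}}^{y,k}$ and the central-difference approximations of $\partial h/\partial x$, $\partial h/\partial y$ are those of the schemes O2_ES ($k=2$), O3_ES ($k=3$) and O4_ES ($k=4$) defined in the context. Then each of these three schemes is entropy stable: there exist numerical entropy fluxes $\hat q^x_{i+\frac12,j}$ and $\hat q^y_{i,j+\frac12}$, consistent with $q^x$ and $q^y$ respectively, such that every solution of the scheme with values $\mathbf{U}_{i,j}(t)$ in the admissible set $\Omega$ satisfies $$\frac{d}{dt}\eta(\mathbf{U}_{i,j})+\frac{1}{\Delta x}\Big(\hat q^x_{i+\frac12,j}-\hat q^x_{i-\frac12,j}\Big)+\frac{1}{\Delta y}\Big(\hat q^y_{i,j+\frac12}-\hat q^y_{i,j-\frac12}\Big)\le 0 .$$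
   Context: **System.** The primitive variables are $\mathbf{W}=(h,v_1,v_2,\mathcal{P}_{11},\mathcal{P}_{12},\mathcal{P}_{22})^\top$ with $h$ the water depth, $(v_1,v_2)$ the velocity and $\mathcal{P}$ the symmetric $2\times2$ stress tensor; $g>0$ is constant; $\mathcal{E}_{ab}=\frac h2(v_av_b+\mathcal{P}_{ab})$. The system is $\partial_t\mathbf{U}+\partial_x\mathbf{F}^x+\partial_y\mathbf{F}^y+\mathbf{B}^x\partial_xh+\mathbf{B}^y\partial_yh=0$ with $\mathbf{U}=(h,hv_1,hv_2,\mathcal{E}_{11},\mathcal{E}_{12},\mathcal{E}_{22})^\top$, $$\mathbf{F}^x=\begin{pmatrix}hv_1\\ h(v_1^2+\mathcal{P}_{11})\\ h(v_1v_2+\mathcal{P}_{12})\\ \frac12 hv_1(v_1^2+3\mathcal{P}_{11})\\ \frac12 h(v_1^2v_2+2v_1\mathcal{P}_{12}+v_2\mathcal{P}_{11})\\ \frac12 h(v_1v_2^2+2v_2\mathcal{P}_{12}+v_1\mathcal{P}_{22})\end{pmatrix},\quad \mathbf{F}^y=\begin{pmatrix}hv_2\\ h(v_1v_2+\mathcal{P}_{12})\\ h(v_2^2+\mathcal{P}_{22})\\ \frac12 h(v_1^2v_2+2v_1\mathcal{P}_{12}+v_2\mathcal{P}_{11})\\ \frac12 h(v_1v_2^2+2v_2\mathcal{P}_{12}+v_1\mathcal{P}_{22})\\ \frac12 h(v_2^3+3v_2\mathcal{P}_{22})\end{pmatrix},$$ $\mathbf{B}^x=(0,gh,0,ghv_1,\frac12ghv_2,0)^\top$,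 $\mathbf{B}^y=(0,0,gh,0,\frac12ghv_1,ghv_2)^\top$. The admissible set is $\Omega=\{\mathbf{U}: h>0,\ \mathcal{P}\text{ positive definite}\}$. **Entropy.** $s=\log\big((\mathcal{P}_{11}\mathcal{P}_{22}-\mathcal{P}_{12}^2)/h^2\big)$, $\eta=-hs$, $q^x=-hv_1s$, $q^y=-hv_2s$. The entropy variable is $\mathbf{V}=\partial\eta/\partial\mathbf{U}$ (as a column vector). A numerical entropy flux is consistent with $q^d$ if it equals $q^d(\mathbf{U})$ when all its arguments equal $\mathbf{U}$. **Grid.** Uniform rectangular grid with points $(x_i,y_j)$, mesh sizes $\Delta x,\Delta y$ and interfaces $x_{i+\frac12}=\frac{x_i+x_{i+1}}2$, $y_{j+\frac12}=\frac{y_j+y_{j+1}}2$; statements are for indices at which all stencil values are defined (e.g. after periodic extension). **Two-point entropy conservative fluxes.** For two admissible states write $\bar a$ for the arithmetic mean of the two values of a quantity $a$, and $a^{\ln}=(a_R-a_L)/(\ln a_R-\ln a_L)$ for the logarithmic mean ($a^{\ln}=a_L$ if $a_L=a_R$). Put $D=\mathcal{P}_{11}\mathcal{P}_{22}-\mathcal{P}_{12}^2$, $\beta_{ab}=\mathcal{P}_{ab}/D$, $D_\beta=\beta_{11}\beta_{22}-\beta_{12}^2$, $\Delta_\beta=\bar\beta_{11}\bar\beta_{22}-(\bar\beta_{12})^2$. Then $\tilde{\mathbf{F}}^x=(\tilde f_1,\dots,\tilde f_6)^\top$ with $\tilde f_1=h^{\ln}\bar v_1$, $\tilde f_2=\bar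 v_1\tilde f_1+\bar\beta_{11}\bar h/\Delta_\beta$, $\tilde f_3=\bar v_2\tilde f_1+\bar\beta_{12}\bar h/\Delta_\beta$, $\tilde f_4=\frac12\big(\bar\beta_{11}/D_\beta^{\ln}-\overline{v_1^2}\big)\tilde f_1+\bar v_1\tilde f_2$, $\tilde f_5=\frac12\big[\big(\bar\beta_{12}/D_\beta^{\ln}-\overline{v_1v_2}\big)\tilde f_1+\bar v_1\tilde f_3+\bar v_2\tilde f_2\big]$, $\tilde f_6=\frac12\big(\bar\beta_{22}/D_\beta^{\ln}-\overline{v_2^2}\big)\tilde f_1+\bar v_2\tilde f_3$; and $\tilde{\mathbf{F}}^y=(\tilde g_1,\dots,\tilde g_6)^\top$ with $\tilde g_1=h^{\ln}\bar v_2$, $\tilde g_2=\bar v_1\tilde g_1+\bar\beta_{12}\bar h/\Delta_\beta$, $\tilde g_3=\bar v_2\tilde g_1+\bar\beta_{22}\bar h/\Delta_\beta$, and $\tilde g_4,\tilde g_5,\tilde g_6$ given by the formulas for $\tilde f_4,\tilde f_5,\tilde f_6$ with $\tilde f_1,\tilde f_2,\tilde f_3$ replaced by $\tilde g_1,\tilde g_2,\tilde g_3$. Second order: $\tilde{\mathbf{F}}^{x,2}_{i+\frac12,j}=\tilde{\mathbf{F}}^x(\mathbf{U}_{i,j},\mathbf{U}_{i+1,j})$. Fourth order: $$\tilde{\mathbf{F}}^{x,4}_{i+\frac12,j}=\tfrac43\tilde{\mathbf{F}}^x(\mathbf{U}_{i,j},\mathbf{U}_{i+1,j})-\tfrac16\big(\tilde{\mathbf{F}}^x(\mathbf{U}_{i-1,j},\mathbf{U}_{i+1,j})+\tilde{\mathbf{F}}^x(\mathbf{U}_{i,j},\mathbf{U}_{i+2,j})\big);$$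 analogously in $y$ with shifts in the index $j$. **Diffusion matrices.** $\mathbf{D}^x_{i+\frac12,j}=\tilde R^x\Lambda^x\tilde R^{x\top}$, $\mathbf{D}^y_{i,j+\frac12}=\tilde R^y\Lambda^y\tilde R^{y\top}$, evaluated at an admissible averaged state at the interface. Here $\Lambda^d=\big(\max_k|\lambda^d_k|\big)I_6$, where $\lambda^d_k$ are the eigenvalues of $\partial\mathbf{F}^d/\partial\mathbf{U}$: for $d=x$ they are $v_1,v_1,v_1\pm\sqrt{\mathcal{P}_{11}},v_1\pm\sqrt{3\mathcal{P}_{11}}$ and for $d=y$ they are $v_2,v_2,v_2\pm\sqrt{\mathcal{P}_{22}},v_2\pm\sqrt{3\mathcal{P}_{22}}$. The matrix $\tilde R^d=\frac{\partial\mathbf{U}}{\partial\mathbf{W}}R^d_{\mathbf{W}}T^d$ is the matrix of entropy-scaled right eigenvectors of $\partial\mathbf{F}^d/\partial\mathbf{U}$ (it satisfies $\tilde R^d\tilde R^{d\top}=\partial\mathbf{U}/\partial\mathbf{V}$), where, writing $P_{ab}$ for $\mathcal{P}_{ab}$, $$R^x_{\mathbf{W}}=\begin{pmatrix}hP_{11}&0&-h&0&0&hP_{11}\\ -\sqrt{3P_{11}}P_{11}&0&0&0&0&\sqrt{3P_{11}}P_{11}\\ -\sqrt{3P_{11}}P_{12}&-\sqrt{P_{11}}&0&0&\sqrt{P_{11}}&\sqrt{3P_{11}}P_{12}\\ 2P_{11}^2&0&P_{11}&0&0&2P_{11}^2\\ 2P_{11}P_{12}&P_{11}&P_{12}&0&P_{11}&2P_{11}P_{12}\\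 2P_{12}^2&2P_{12}&0&1&2P_{12}&2P_{12}^2\end{pmatrix},$$ $$R^y_{\mathbf{W}}=\begin{pmatrix}hP_{22}&0&-h&0&0&hP_{22}\\ -\sqrt{3P_{22}}P_{12}&-\sqrt{P_{22}}&0&0&\sqrt{P_{22}}&\sqrt{3P_{22}}P_{12}\\ -\sqrt{3P_{22}}P_{22}&0&0&0&0&\sqrt{3P_{22}}P_{22}\\ 2P_{12}^2&2P_{12}&0&1&2P_{12}&2P_{12}^2\\ 2P_{22}P_{12}&P_{22}&P_{12}&0&P_{22}&2P_{22}P_{12}\\ 2P_{22}^2&0&P_{22}&0&0&2P_{22}^2\end{pmatrix},$$ and $T^d$ is the symmetric positive definite square root of the block diagonal matrix $Y^d$ whose diagonal entries in positions 1 and 6 are $\frac1{12hp^2}$, in positions 2 and 5 are $\frac{D}{4hp^2}$, and whose block in rows/columns 3,4 is $$\begin{pmatrix}\frac1{3h}&\frac{P_{12}^2}{3hp}\\ \frac{P_{12}^2}{3hp}&\frac{3D^2+P_{12}^4}{3hp^2}\end{pmatrix},$$ with $p=P_{11}$ for $d=x$ and $p=P_{22}$ for $d=y$. **Entropy stable fluxes.** For $k\in\{2,3,4\}$ let $2p=2$ if $k=2$ and $2p=4$ if $k=3,4$, and $$\hat{\mathbf{F}}^{x,k}_{i+\frac12,j}=\tilde{\mathbf{F}}^{x,2p}_{i+\frac12,j}-\tfrac12\mathbf{D}^x_{i+\frac12,j}\big(\tilde{\mathbf{V}}^{x,-}_{i+1,j}-\tilde{\mathbf{V}}^{x,+}_{i,j}\big),\qquad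 \tilde{\mathbf{V}}^{x,\pm}_{i,j}=\big(\tilde R^{x\top}_{i\pm\frac12,j}\big)^{-1}\tilde{\mathcal{V}}^{x,\pm}_{i,j},$$ where $\mathcal{V}^{x,\pm}_{i,j}=\tilde R^{x\top}_{i\pm\frac12,j}\mathbf{V}_{i,j}$ are the scaled entropy variables and $\tilde{\mathcal{V}}^{x,+}_{i,j}$, $\tilde{\mathcal{V}}^{x,-}_{i+1,j}$ are their $k$-th order componentwise reconstructions (in the $x$-direction) at the interface $x_{i+\frac12}$ from cells $i$ and $i+1$. The reconstruction is minmod for $k=2$ (piecewise linear, value at the right/left interface of cell $m$ equal to $w_m\pm\frac12\mathrm{minmod}(w_{m+1}-w_m,w_m-w_{m-1})$), and the standard ENO reconstruction of order $k$ (polynomials of degree $k-1$ on adaptively selected stencils) for $k=3,4$. These reconstructions are sign preserving: each component of the reconstructed jump $\tilde{\mathcal{V}}^{x,-}_{i+1,j}-\tilde{\mathcal{V}}^{x,+}_{i,j}$ is zero or has the same sign as the corresponding component of the original jump $\mathcal{V}^{x,-}_{i+1,j}-\mathcal{V}^{x,+}_{i,j}=\tilde R^{x\top}_{i+\frac12,j}(\mathbf{V}_{i+1,j}-\mathbf{V}_{i,j})$, and is zero if the latter is zero. The $y$-direction fluxes are defined in the same way. **Schemes.** O2_ES: $k=2$ with second-order central differences for $(\partial h/\partial x)_{i,j}$, $(\partial h/\partial y)_{i,j}$. O3_ES: $k=3$, and O4_ES: $k=4$, both with fourth-order central differences for these derivatives. *)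

(* Defs.v *)
From HB Require Import structures.
From mathcomp Require Import all_boot all_order all_algebra.
From mathcomp Require Import all_classical all_reals all_analysis.

Set Implicit Arguments.
Unset Strict Implicit.
Unset Printing Implicit Defensive.

Import Order.TTheory GRing.Theory Num.Theory numFieldNormedType.Exports.

Local Open Scope classical_set_scope.
Local Open Scope ring_scope.

Local Notation coord w k := (w (@Ordinal 6 k%N isT) 0).

Definition col6 (R : realType) (s : seq R) : 'cV[R]_6 := \col_i s`_i.

Definition mx_of_rows (R : realType) m n (s : seq (seq R)) : 'M[R]_(m, n) :=
  \matrix_(i, j) (nth [::] s i)`_j.

Definition posdef (R : realType) n (A : 'M[R]_n) :=
  forall x : 'cV[R]_n, x != 0 -> 0 < (x^T *m A *m x) 0 0.

(* Entry (i, j) is the partial derivative of f_i with respect to x_j; [delta_mx]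
   is the canonical basis.  (The library's [jacobian] is for row vectors and is
   the transpose of this.) *)
Definition jacmx (R : realType) (f : 'cV[R]_6 -> 'cV[R]_6) (x : 'cV[R]_6) :
  'M[R]_6 := \matrix_(i, j) ('D_(delta_mx j 0) f x) i 0.

Definition gradient (R : realType) (f : 'cV[R]_6 -> R) (x : 'cV[R]_6) :
  'cV[R]_6 := \col_k 'D_(delta_mx k 0) f x.

(* The symmetric positive definite square root; it exists and is unique when Y
   is symmetric positive definite. *)
Definition spd_sqrt (R : realType) n (Y : 'M[R]_n) : 'M[R]_n :=
  get [set T : 'M[R]_n | [/\ T^T = T, posdef T & T *m T = Y]].

(** Primitive variables W = (h, v1, v2, P11, P12, P22) and conserved variables
    U = (h, h v1, h v2, E11, E12, E22) *)

Section States.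
Context (R : realType).
Implicit Types W U : 'cV[R]_6.

Definition depth W : R := coord W 0.
Definition vel1 W : R := coord W 1.
Definition vel2 W : R := coord W 2.
Definition P11 W : R := coord W 3.
Definition P12 W : R := coord W 4.
Definition P22 W : R := coord W 5.

Definition conserved W : 'cV[R]_6 :=
  let h := depth W in let v1 := vel1 W in let v2 := vel2 W in
  col6 [:: h; h * v1; h * v2;
           h / 2 * (v1 * v1 + P11 W);
           h / 2 * (v1 * v2 + P12 W);
           h / 2 * (v2 * v2 + P22 W)].

(* The inverse of [conserved] where h <> 0. *)
Definition primitive U : 'cV[R]_6 :=
  let h := coord U 0 in
  let v1 := coord U 1 / h in let v2 := coord U 2 / h in
  col6 [:: h; v1; v2;
           2 * coord U 3 / h - v1 * v1;
           2 * coord U 4 / h - v1 * v2;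
           2 * coord U 5 / h - v2 * v2].

Definition stress W : 'M[R]_2 :=
  mx_of_rows 2 2 [:: [:: P11 W; P12 W]; [:: P12 W; P22 W]].

Definition admissible U : Prop :=
  0 < depth (primitive U) /\ posdef (stress (primitive U)).

Definition detP W : R := P11 W * P22 W - P12 W ^+ 2.

Definition Bx (g : R) W : 'cV[R]_6 :=
  let h := depth W in
  col6 [:: 0; g * h; 0; g * h * vel1 W; 2^-1 * g * h * vel2 W; 0].

Definition By (g : R) W : 'cV[R]_6 :=
  let h := depth W in
  col6 [:: 0; 0; g * h; 0; 2^-1 * g * h * vel1 W; g * h * vel2 W].

(** Entropy pair, as functions of the conserved variables *)

Definition spec_entropy U : R :=
  let W := primitive U in ln (detP W / depth W ^+ 2).

Definition entropy U : R := - depth (primitive U) * spec_entropy U.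
Definition qx U : R := - depth (primitive U) * vel1 (primitive U) * spec_entropy U.
Definition qy U : R := - depth (primitive U) * vel2 (primitive U) * spec_entropy U.

Definition entropy_var U : 'cV[R]_6 := gradient entropy U.

(** Two-point entropy conservative fluxes, for primitive states WL and WR *)

Definition mean (f : 'cV[R]_6 -> R) WL WR : R := (f WL + f WR) / 2.

Definition logmean (f : 'cV[R]_6 -> R) WL WR : R :=
  if f WL == f WR then f WL else (f WR - f WL) / (ln (f WR) - ln (f WL)).

Definition beta11 W : R := P11 W / detP W.
Definition beta12 W : R := P12 W / detP W.
Definition beta22 W : R := P22 W / detP W.
Definition Dbeta W : R := beta11 W * beta22 W - beta12 W ^+ 2.

Definition Delta_beta WL WR : R :=
  mean beta11 WL WR * mean beta22 WL WR - mean beta12 WL WR ^+ 2.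

(* The last three components are the same functions of the first three in both
   directions. *)
Definition ec_complete WL WR (f1 f2 f3 : R) : 'cV[R]_6 :=
  let v1 := mean vel1 WL WR in let v2 := mean vel2 WL WR in
  let Dln := logmean Dbeta WL WR in
  col6 [:: f1; f2; f3;
    2^-1 * (mean beta11 WL WR / Dln - mean (fun W => vel1 W ^+ 2) WL WR) * f1
      + v1 * f2;
    2^-1 * ((mean beta12 WL WR / Dln
               - mean (fun W => vel1 W * vel2 W) WL WR) * f1
      + v1 * f3 + v2 * f2);
    2^-1 * (mean beta22 WL WR / Dln - mean (fun W => vel2 W ^+ 2) WL WR) * f1
      + v2 * f3].

Definition ec_x WL WR : 'cV[R]_6 :=
  let v1 := mean vel1 WL WR in let v2 := mean vel2 WL WR in
  let h := mean depth WL WR in let Db := Delta_beta WL WR in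
  let f1 := logmean depth WL WR * v1 in
  ec_complete WL WR f1 (v1 * f1 + mean beta11 WL WR * h / Db)
                       (v2 * f1 + mean beta12 WL WR * h / Db).

Definition ec_y WL WR : 'cV[R]_6 :=
  let v1 := mean vel1 WL WR in let v2 := mean vel2 WL WR in
  let h := mean depth WL WR in let Db := Delta_beta WL WR in
  let g1 := logmean depth WL WR * v2 in
  ec_complete WL WR g1 (v1 * g1 + mean beta12 WL WR * h / Db)
                       (v2 * g1 + mean beta22 WL WR * h / Db).

(** Entropy-scaled right eigenvectors *)

Definition RWx W : 'M[R]_6 :=
  let h := depth W in let p11 := P11 W in let p12 := P12 W in
  let r := Num.sqrt p11 in let r3 := Num.sqrt (3 * p11) in
  mx_of_rows 6 6
  [:: [:: h * p11;       0;       - h; 0; 0;       h * p11];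
      [:: - (r3 * p11);  0;       0;   0; 0;       r3 * p11];
      [:: - (r3 * p12);  - r;     0;   0; r;       r3 * p12];
      [:: 2 * p11 ^+ 2;  0;       p11; 0; 0;       2 * p11 ^+ 2];
      [:: 2 * p11 * p12; p11;     p12; 0; p11;     2 * p11 * p12];
      [:: 2 * p12 ^+ 2;  2 * p12; 0;   1; 2 * p12; 2 * p12 ^+ 2]].

Definition RWy W : 'M[R]_6 :=
  let h := depth W in let p22 := P22 W in let p12 := P12 W in
  let r := Num.sqrt p22 in let r3 := Num.sqrt (3 * p22) in
  mx_of_rows 6 6
  [:: [:: h * p22;       0;       - h; 0; 0;       h * p22];
      [:: - (r3 * p12);  - r;     0;   0; r;       r3 * p12];
      [:: - (r3 * p22);  0;       0;   0; 0;       r3 * p22];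
      [:: 2 * p12 ^+ 2;  2 * p12; 0;   1; 2 * p12; 2 * p12 ^+ 2];
      [:: 2 * p22 * p12; p22;     p12; 0; p22;     2 * p22 * p12];
      [:: 2 * p22 ^+ 2;  0;       p22; 0; 0;       2 * p22 ^+ 2]].

(* p is P11 in the x-direction and P22 in the y-direction. *)
Definition Ymx W (p : R) : 'M[R]_6 :=
  let h := depth W in let D := detP W in let p12 := P12 W in
  let a := (12 * h * p ^+ 2)^-1 in
  let b := D / (4 * h * p ^+ 2) in
  let c := p12 ^+ 2 / (3 * h * p) in
  mx_of_rows 6 6
  [:: [:: a; 0; 0;            0; 0; 0];
      [:: 0; b; 0;            0; 0; 0];
      [:: 0; 0; (3 * h)^-1;   c; 0; 0];
      [:: 0; 0; c; (3 * D ^+ 2 + p12 ^+ 4) / (3 * h * p ^+ 2); 0; 0];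
      [:: 0; 0; 0;            0; b; 0];
      [:: 0; 0; 0;            0; 0; a]].

Definition Rtilde_x W : 'M[R]_6 :=
  jacmx conserved W *m RWx W *m spd_sqrt (Ymx W (P11 W)).
Definition Rtilde_y W : 'M[R]_6 :=
  jacmx conserved W *m RWy W *m spd_sqrt (Ymx W (P22 W)).

Definition eigenvalues_x W : seq R :=
  let v := vel1 W in
  let c := Num.sqrt (P11 W) in let c3 := Num.sqrt (3 * P11 W) in
  [:: v; v; v - c; v + c; v - c3; v + c3].

Definition eigenvalues_y W : seq R :=
  let v := vel2 W in
  let c := Num.sqrt (P22 W) in let c3 := Num.sqrt (3 * P22 W) in
  [:: v; v; v - c; v + c; v - c3; v + c3].

Definition Lambda (l : seq R) : 'M[R]_6 :=
  (\big[Num.max/0]_(x <- l) `|x|)%:M.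

End States.

(** Reconstruction of a grid function w from cell values *)

Section Reconstruction.
Context (R : realType).
Implicit Types (w : int -> R) (m : int) (k : nat).

Definition minmod (a b : R) : R :=
  if (0 < a) && (0 < b) then Num.min a b
  else if (a < 0) && (b < 0) then Num.max a b else 0.

Definition minmod_slope w m : R := minmod (w (m + 1) - w m) (w m - w (m - 1)).

(* n-th undivided forward difference of w, on the cells m, ..., m + n *)
Fixpoint undiff n w m : R :=
  if n is n'.+1 then undiff n' w (m + 1) - undiff n' w m else w m.

(* First cell of the ENO stencil of n + 1 cells for cell m: starting from the
   cell itself, the stencil is repeatedly extended by the cell on its left or on
   its right, whichever gives the smaller next undivided difference in absolute
   value; a tie is resolved to the right. *)
Fixpoint eno_start n w m : int :=
  if n is n'.+1 then
    let s := eno_start n' w m in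
    if `|undiff n w (s - 1)| < `|undiff n w s| then s - 1 else s
  else m.

(* The polynomial of degree < k whose averages over the k unit cells s, ...,
   s + k - 1 are the values of w there, in the coordinate for which cell s + l
   is [l, l + 1].  It is the derivative of the interpolant at 0, ..., k of the
   primitive function, whose value at n is w s + ... + w (s + n - 1). *)
Definition cell_poly k w (s : int) : {poly R} :=
  (\sum_(n < k.+1) (\sum_(l < n) w (s + l%:Z)) *:
     (tnth (lagrange k.+1 (fun a => a%:R)) n : {poly R}))^`()%R.

(* Values of the k-th order reconstruction in cell m at its right and left
   interfaces. *)
Definition recon_right k w m : R :=
  if k == 2%N then w m + 2^-1 * minmod_slope w m
  else let s := eno_start k.-1 w m in (cell_poly k w s).[(m - s + 1)%:~R].

Definition recon_left k w m : R :=
  if k == 2%N then w m - 2^-1 * minmod_slope w m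
  else let s := eno_start k.-1 w m in (cell_poly k w s).[(m - s)%:~R].

End Reconstruction.

(** The schemes, for k = 2 (O2_ES), 3 (O3_ES) and 4 (O4_ES) *)

Section Schemes.
Context (R : realType).
Local Notation state := 'cV[R]_6.
(* u is a grid line of conserved states in the direction considered; the
   interface of index i is the one between the cells i and i + 1. *)
Implicit Types (u : int -> state) (i j : int) (k : nat).

Definition ec_flux (ec : state -> state -> state) k u i : state :=
  let f a b := ec (primitive (u a)) (primitive (u b)) in
  if k == 2%N then f i (i + 1)
  else (4 / 3) *: f i (i + 1) - 6^-1 *: (f (i - 1) (i + 1) + f i (i + 2)).

(* [avg] gives the averaged state at the interface.  All the cells of the
   stencils used at an interface are scaled by the matrix of that interface. *)
Definition es_flux (ec : state -> state -> state) (Rtilde : state -> 'M[R]_6)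
    (eigenvalues : state -> seq R) (avg : state -> state -> state)
    k u i : state :=
  let A := primitive (avg (u i) (u (i + 1))) in
  let Rt := Rtilde A in
  let D := Rt *m Lambda (eigenvalues A) *m Rt^T in
  let w c m := (Rt^T *m entropy_var (u m)) c 0 in
  let Vplus := invmx Rt^T *m \col_c recon_right k (w c) i in
  let Vminus := invmx Rt^T *m \col_c recon_left k (w c) (i + 1) in
  ec_flux ec k u i - 2^-1 *: (D *m (Vminus - Vplus)).

Definition es_flux_x := es_flux (@ec_x R) (@Rtilde_x R) (@eigenvalues_x R).
Definition es_flux_y := es_flux (@ec_y R) (@Rtilde_y R) (@eigenvalues_y R).

Definition central_diff k (d : R) (f : int -> R) i : R :=
  if k == 2%N then (f (i + 1) - f (i - 1)) / (2 * d)
  else (- f (i + 2) + 8 * f (i + 1) - 8 * f (i - 1) + f (i - 2)) / (12 * d).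

(* The sum of all the terms other than dU_(i, j)/dt in the scheme *)
Definition spatial_terms (g dx dy : R) (avgx avgy : state -> state -> state)
    k (U : int -> int -> state) i j : state :=
  let Fx := es_flux_x avgx k (fun a => U a j) in
  let Fy := es_flux_y avgy k (fun b => U i b) in
  let W := primitive (U i j) in
  dx^-1 *: (Fx i - Fx (i - 1)) + dy^-1 *: (Fy j - Fy (j - 1))
  + central_diff k dx (fun a => depth (primitive (U a j))) i *: Bx g W
  + central_diff k dy (fun b => depth (primitive (U i b))) j *: By g W.

(* An admissible solution for the times in J: the scheme holds at the grid
   points of G, the other grid points carrying ghost or extended values. *)
Definition solution (g dx dy : R) (avgx avgy : state -> state -> state) k
    (J : set R) (G : set (int * int)) (U : R -> int -> int -> state) : Prop :=
  forall t, J t ->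
    (forall i j, admissible (U t i j)) /\
    (forall i j, G (i, j) ->
       derivable (fun s => U s i j) t 1 /\
       derive1 (fun s => U s i j) t
         + spatial_terms g dx dy avgx avgy k (U t) i j = 0).

(* A numerical entropy flux at the interface i is a function of the states in
   the 2k cells i - k + 1, ..., i + k, which contain the stencil of the
   numerical flux there. *)
Definition num_entropy_flux k := {ffun 'I_k.*2 -> state} -> R.

Definition at_interface k (q : num_entropy_flux k) u i : R :=
  q [ffun m : 'I_k.*2 => u (i + m%:Z - k%:Z + 1)].

Definition consistent k (q : num_entropy_flux k) (q0 : state -> R) : Prop :=
  forall V, admissible V -> q [ffun => V] = q0 V.

Definition admissible_avg (avg : state -> state -> state) : Prop :=
  forall UL UR, admissible UL -> admissible UR -> admissible (avg UL UR).

End Schemes.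

(* Main.v *)
Require Import Defs.
From HB Require Import structures.
From mathcomp Require Import all_boot all_order all_algebra.
From mathcomp Require Import all_classical all_reals all_analysis.
From mathcomp Require Import zify ring lra.

Import Order.TTheory GRing.Theory Num.Theory numFieldNormedType.Exports.

Local Open Scope classical_set_scope.
Local Open Scope ring_scope.

(* The entropy variable V is orthogonal to the nonconservative terms B^x, B^y, and
   the two-point fluxes satisfy [V] . F = [psi] with potentials psi^x = 2 h v1 and
   psi^y = 2 h v2.  Hence V_a . F(a, b) and V_b . F(a, b) equal q(a, b) + psi_a and
   q(a, b) + psi_b with q = mean V . F - mean psi, and the conservative parts of
   the schemes telescope for both orders.  For the entropy stable flux one also
   subtracts (V_i + V_{i+1}) . D [[V]] / 4 from the entropy flux; the remainder is
   [V] . D [[V]] / 4 = lambda (R^T [V]) . [[R^T V]] / 4, which is nonnegative as the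
   reconstruction preserves signs.

   For ENO, the reconstructed jump is a sum, over the stencils between those
   selected in the two cells, of positive multiples of differences of order k with
   alternating signs; the stencil selection forces these signs by induction on
   the order. *)

(** * Sign preservation of the reconstructions *)

Section ENO.
Context {R : realType}.
Implicit Types (w : int -> R) (m s : int) (n k : nat) (a b e : R).

Lemma undiffS n w m : undiff n.+1 w m = undiff n w (m + 1) - undiff n w m.
Proof. by []. Qed.

Lemma eno_startS n w m :
  eno_start n.+1 w m = let s := eno_start n w m in
    if `|undiff n.+1 w (s - 1)| < `|undiff n.+1 w s| then s - 1 else s.
Proof. by []. Qed.

Lemma eno_start_bounds n w m : m - n%:Z <= eno_start n w m <= m.
Proof. by elim: n => [|n IHn] /=; [lia | case: ifP => _; lia]. Qed.

(** Equal starts make the same choice, and distinct ones are at least 1 apart while each moves left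
    by at most 1. *)
Lemma eno_start_mono n w m : eno_start n w m <= eno_start n w (m + 1).
Proof.
elim: n => [|n IHn]; first by rewrite /=; lia.
rewrite !eno_startS; cbv zeta.
have [->//|sNs'] := eqVneq (eno_start n w m) (eno_start n w (m + 1)).
by case: ifP => _; case: ifP => _; lia.
Qed.

(** [e * a <= |e| * |a| <= |e| * |b| = e * b]; this turns the comparison made by the stencil
    selection into a sign. *)
Lemma mulrB_ge0_norm e a b : `|a| <= `|b| -> 0 <= e * b -> 0 <= e * (b - a).
Proof.
move=> leab eb0; rewrite mulrBr subr_ge0 (le_trans (ler_norm _))//.
by rewrite -(ger0_norm eb0) !normrM ler_wpM2l.
Qed.

(* The differences of order [n + 1] starting between the stencils of two
   neighbouring cells alternate in sign; this survives the passage to the next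
   order because an enlarged stencil only adds a difference dominated by its
   neighbour. *)
Lemma eno_alternating n w m e s : 0 <= e * (w (m + 1) - w m) ->
  eno_start n w m <= s < eno_start n w (m + 1) ->
  0 <= e * (-1) ^ (s - m + n%:Z) * undiff n.+1 w s.
Proof.
move=> ed0; elim: n s => [|n IHn] s.
  rewrite [eno_start 0 w m]/= [eno_start 0 w (m + 1)]/= => ms.
  have -> : s = m by lia.
  by rewrite subrr expr0z mulr1.
have shift_sign z : (-1) ^ (z + 1) = - (-1) ^ z :> R.
  by rewrite exprzDr ?unitrN1// expr1z mulrN1.
rewrite !eno_startS (undiffS n.+1); cbv zeta.
set r := eno_start n w m in IHn *; set r' := eno_start n w (m + 1) in IHn *.
have rr' : r <= r' := eno_start_mono n w m.
have [rE|rNr'] := eqVneq r r'; first by rewrite rE; case: ifP => _; lia.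
have hs : s - m + n.+1%:Z = s - m + n%:Z + 1 by lia.
have hs1 : s + 1 - m + n%:Z = s - m + n.+1%:Z by lia.
move=> srange.
have [s_in|s_out] := boolP (r <= s).
  have s_rr' : r <= s < r' by move: srange; do 2 case: ifP => _; lia.
  have ha := IHn _ s_rr'.
  rewrite hs shift_sign mulrN mulNr -mulrN opprB.
  have [s1_in|s1_out] := boolP (s + 1 < r').
    have /IHn : r <= s + 1 < r' by lia.
    rewrite hs1 hs shift_sign mulrN mulNr => hb.
    by rewrite mulrBr addr_ge0.
  (* Here the stencil of the right cell kept its start [s + 1], so the difference at [s] was at
     least as large in absolute value. *)
  move: srange; have <- : s + 1 = r' by lia.
  rewrite addrK; case: (ltP `|undiff n.+1 w s|) => [|leba _].
    by case: ifP => _ _; lia.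
  exact: mulrB_ge0_norm.
(* Here the stencil of the left cell moved to [s], so the difference there was smaller in absolute
   value than at [s + 1]. *)
have sE : r - 1 = s by move: srange s_out; do 2 case: ifP => _; lia.
have /IHn : r <= s + 1 < r' by lia.
rewrite hs1 => hb; apply: mulrB_ge0_norm => //.
move: srange; rewrite sE.
have -> : r = s + 1 by lia.
by case: ltP => [/ltW//|_]; lia.
Qed.

(** * Polynomials on neighbouring stencils *)

Definition primitive_poly k w s : {poly R} :=
  \sum_(n < k.+1) (\sum_(l < n) w (s + l%:Z)) *:
    (tnth (lagrange k.+1 (fun a : nat => a%:R)) n : {poly R}).

Lemma cell_polyE k w s : cell_poly k w s = (primitive_poly k w s)^`()%R.
Proof. by []. Qed.

Lemma size_primitive_poly k w s : (size (primitive_poly k w s) <= k.+1)%N.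
Proof.
apply: (leq_trans (size_sum _ _ _)); apply/bigmax_leqP => i _.
by rewrite (leq_trans (size_scale_leq _ _))// size_npoly.
Qed.

Lemma primitive_poly_nat k w s j : (j <= k)%N ->
  (primitive_poly k w s).[j%:R] = \sum_(l < j) w (s + l%:Z).
Proof.
move=> jk; have natr_inj : injective (fun a : nat => a%:R : R).
  by move=> a b /(mulrIn (oner_neq0 R)).
rewrite horner_sum (bigD1 (Ordinal (jk : (j < k.+1)%N)))//=.
rewrite hornerZ (lagrange_sample _ natr_inj (Ordinal _) (Ordinal _))// eqxx mulr1.
rewrite [X in _ + X]big1 ?addr0// => i ij.
by rewrite hornerZ (lagrange_sample _ natr_inj i (Ordinal _))// (negPf ij) mulr0.
Qed.

(** In the coordinate of the stencil [s], the two interpolants agree at the nodes 1, ..., k up to an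
    additive constant, so they differ by that constant and [undiff k w s / k!] times the product of
    the [x - j]. Its derivative at [q + 1] gives [c = q! (k - 1 - q)! / k!] and the sign. *)
Lemma cell_poly_shift k w s q : (k == 3)%N || (k == 4)%N -> (q < k)%N ->
  exists2 c : R, 0 <= c &
    (cell_poly k w (s + 1)).[q%:R] - (cell_poly k w s).[q.+1%:R]
    = c * ((-1) ^+ (k.-1 - q) * undiff k w s).
Proof.
move=> k34 qk; exists ((q`! * (k.-1 - q)`!)%:R / k`!%:R).
  by rewrite divr_ge0.
(* Both orders are treated with quartic coefficients; the interpolation conditions become linear
   equations in them, left to [lra] for each [q]. *)
have size5 s' : (size (primitive_poly k w s') <= 5)%N.
  by rewrite (leq_trans (size_primitive_poly _ _ _))//; case/orP: k34 => /eqP->.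
have hornerE5 s' x : (primitive_poly k w s').[x] = (primitive_poly k w s')`_0
   + (primitive_poly k w s')`_1 * x + (primitive_poly k w s')`_2 * x ^+ 2
   + (primitive_poly k w s')`_3 * x ^+ 3 + (primitive_poly k w s')`_4 * x ^+ 4.
  rewrite (horner_coef_wide _ (size5 s')) !big_ord_recl big_ord0 /=.
  by rewrite /bump /= !add1n; ring.
have derivE5 s' x : (cell_poly k w s').[x] = (primitive_poly k w s')`_1
   + (primitive_poly k w s')`_2 * 2 * x + (primitive_poly k w s')`_3 * 3 * x ^+ 2
   + (primitive_poly k w s')`_4 * 4 * x ^+ 3.
  have size4 : (size (cell_poly k w s') <= 4)%N.
    rewrite cell_polyE; have [->|p0] := eqVneq (primitive_poly k w s') 0.
      by rewrite raddf0 size_poly0.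
    by rewrite -ltnS (leq_trans (lt_size_deriv p0)).
  rewrite (horner_coef_wide _ size4) !big_ord_recl big_ord0 /= cell_polyE.
  by rewrite !coef_deriv /bump /= !add1n; ring.
have vals s' j : (j <= k)%N -> _ = \sum_(l < j) w (s' + l%:Z) :=
  fun jk => etrans (esym (hornerE5 s' j%:R)) (primitive_poly_nat k w s' j jk).
have p4 s' : k = 3%N -> (primitive_poly k w s')`_4 = 0.
  by move=> k3; rewrite nth_default// k3 size_primitive_poly.
have valsP := vals s; have valsQ := vals (s + 1).
have p4P := p4 s; have p4Q := p4 (s + 1).
rewrite !derivE5; move: valsP valsQ p4P p4Q.
move: (primitive_poly k w s) (primitive_poly k w (s + 1)) => P Q.
move: P`_0 P`_1 P`_2 P`_3 P`_4 Q`_0 Q`_1 Q`_2 Q`_3 Q`_4 => p0 p1 p2 p3 p4_ q0 q1 q2 q3 q4.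
have s0E : w s = w (s + 0%:Z) by congr w; lia.
have s1E : w (s + 1) = w (s + 1%:Z) by [].
have s2E : w (s + 1 + 1) = w (s + 2%:Z) by congr w; lia.
have s3E : w (s + 1 + 1 + 1) = w (s + 3%:Z) by congr w; lia.
have s4E : w (s + 1 + 1 + 1 + 1) = w (s + 4%:Z) by congr w; lia.
have shiftE l : w (s + 1 + l%:Z) = w (s + l.+1%:Z) by congr w; lia.
move=> hP hQ P4 Q4.
case/orP: k34 qk => /eqP kE; subst k => qk.
  have := (hP 0 isT, hP 1 isT, hP 2 isT, hP 3 isT).
  have := (hQ 0 isT, hQ 1 isT, hQ 2 isT, hQ 3 isT).
  rewrite !big_ord_recl !big_ord0 /= /bump /= !add1n !shiftE ?s4E ?s3E ?s2E ?s1E ?s0E.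
  rewrite P4// Q4//.
  case=> -[[]] ? ? ? ? -[[[]]] ? ? ? ?.
  case: q qk => [|[|[|//]]] _; rewrite /= ?factS ?fact0 /=; lra.
have := (hP 0 isT, hP 1 isT, hP 2 isT, hP 3 isT, hP 4 isT).
have := (hQ 0 isT, hQ 1 isT, hQ 2 isT, hQ 3 isT, hQ 4 isT).
rewrite !big_ord_recl !big_ord0 /= /bump /= !add1n !shiftE ?s4E ?s3E ?s2E ?s1E ?s0E.
case=> -[[[]]] ? ? ? ? ? -[[[[]]]] ? ? ? ? ?.
by case: q qk => [|[|[|[|//]]]] _; rewrite /= ?factS ?fact0 /=; lra.
Qed.

(* Letting [e] range over both signs, this says that the reconstructed jump
   vanishes or has the sign of the original one. *)
Lemma eno_sign_preserving k w m e : (k == 3)%N || (k == 4)%N ->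
  0 <= e * (w (m + 1) - w m) ->
  0 <= e * (recon_left k w (m + 1) - recon_right k w m).
Proof.
move=> k34 ed0; have k2 : (k == 2)%N = false by case/orP: k34 => /eqP->.
have k0 : (0 < k)%N by case/orP: k34 => /eqP->.
rewrite /recon_left /recon_right k2.
set r := eno_start k.-1 w m; set r' := eno_start k.-1 w (m + 1).
(* [J s] is the value at the common interface of the two cells given by the stencil starting at [s],
   so the jump telescopes over the starts from [r] to [r']. *)
pose J s := (cell_poly k w s).[(m - s + 1)%:~R].
have -> : m + 1 - r' = m - r' + 1 by lia.
rewrite -/(J r) -/(J r').
have /andP[mr rm] := eno_start_bounds k.-1 w m.
have /andP[mr' rm'] := eno_start_bounds k.-1 w (m + 1).
have rr' : r <= r' := eno_start_mono k.-1 w m.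
have -> : J r' - J r = \sum_(i < `|(r' - r)%R|%N) (J (r + i%:Z + 1) - J (r + i%:Z)).
  rewrite -(big_mkord xpredT (fun i => J (r + i%:Z + 1) - J (r + i%:Z))).
  under eq_bigr => i _ do rewrite -addrA -[i%:Z + 1]/((i + 1)%:Z) addn1.
  rewrite (telescope_sumr (fun i => J (r + i%:Z)))// addr0.
  by congr (J _ - _); lia.
rewrite mulr_sumr; apply: sumr_ge0 => i _; set s := r + i%:Z.
have srange : r <= s < r' by have := ltn_ord i; lia.
have [q qE] : exists q, s = m - q%:Z by exists `|(m - s)%R|%N; lia.
have qk : (q < k)%N by lia.
have [c c0] := cell_poly_shift k w s q k34 qk.
rewrite /J; have -> : m - (s + 1) + 1 = q%:Z by lia.
have -> : m - s + 1 = q.+1%:Z by lia.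
move=> ->; rewrite mulrCA mulr_ge0//.
(* The two alternating signs agree because [s - m + (k - 1) = k - 1 - q]. *)
have := eno_alternating k.-1 w m e s ed0 srange.
have -> : s - m + k.-1%:Z = (k.-1 - q)%:Z by lia.
by rewrite prednK// mulrA.
Qed.

Lemma minmod_sign a b e : 0 <= e * b -> 0 <= e * minmod a b <= e * b.
Proof.
move=> eb0; rewrite /minmod.
case: ifPn => [/andP[a0 b0]|_].
  have e0 : 0 <= e by rewrite -(pmulr_lge0 _ b0).
  rewrite mulr_ge0//=; last by rewrite le_min !ltW.
  by rewrite ler_wpM2l// ge_min lexx orbT.
case: ifPn => [/andP[a0 b0]|_]; last by rewrite mulr0 lexx.
have e0 : e <= 0 by rewrite -(nmulr_lge0 _ b0).
rewrite mulr_le0//=; last by rewrite ge_max !ltW.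
by rewrite ler_wnM2l// le_max lexx orbT.
Qed.

Lemma minmodC a b : minmod a b = minmod b a.
Proof. by rewrite /minmod minC maxC andbC [(a < 0) && _]andbC. Qed.

(** For minmod, each slope lies between 0 and the original jump, and only half of each is subtracted
    from that jump. *)
Lemma recon_sign_preserving k w m e : k \in [:: 2; 3; 4]%N ->
  0 <= e * (w (m + 1) - w m) ->
  0 <= e * (recon_left k w (m + 1) - recon_right k w m).
Proof.
rewrite !inE => /predU1P[->|]; last exact: eno_sign_preserving.
move=> ed0; rewrite /recon_left /recon_right eqxx /minmod_slope addrK.
have /andP[_ h1] := minmod_sign (w (m + 1 + 1) - w (m + 1)) _ e ed0.
have /andP[_ h2] := minmod_sign (w m - w (m - 1)) _ e ed0.
rewrite minmodC in h2; move: (minmod _ _) (minmod _ _) h1 h2 => x y; nra.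
Qed.

End ENO.

(** * Entropy stability along a grid line *)

Section Locality.
Context {R : realType}.
Implicit Types (w : int -> R) (m s i : int) (n k : nat).

Lemma undiff_local n w w' m m' :
  (forall l, (l <= n)%N -> w (m + l%:Z) = w' (m' + l%:Z)) ->
  undiff n w m = undiff n w' m'.
Proof.
elim: n m m' => [|n IHn] m m' ww' /=.
  by have := ww' 0%N isT; rewrite !addr0.
congr (_ - _); apply: IHn => l ln; last by apply: ww'; rewrite ltnW.
have := ww' l.+1 ln; rewrite -!addrA -(_ : 1 + l%:Z = l.+1%:Z)//.
Qed.

(** The selection of order [n + 1] compares differences starting at [s - 1] and [s], with
    [m - n <= s <= m], so it reads only cells at distance at most [n + 1] from [m]. *)
Lemma eno_start_local n w w' m m' :
  (forall a : int, - n%:Z <= a <= n%:Z -> w (m + a) = w' (m' + a)) ->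
  eno_start n w m - m = eno_start n w' m' - m'.
Proof.
elim: n => [|n IHn] ww'; first by rewrite /= !subrr.
have {}IHn : eno_start n w m - m = eno_start n w' m' - m'.
  by apply: IHn => a an; apply: ww'; lia.
have := eno_start_bounds n w m; have := eno_start_bounds n w' m'.
rewrite !eno_startS; cbv zeta; move: (eno_start n w m) (eno_start n w' m') IHn.
move=> s s' ss' ms' ms.
have undiffE d : - 1 <= d <= 0 -> undiff n.+1 w (s + d) = undiff n.+1 w' (s' + d).
  move=> d01; apply: undiff_local => l ln.
  have := ww' (s + d + l%:Z - m); rewrite [X in w X]addrC subrK => ->; last by lia.
  by congr w'; lia.
have := undiffE 0; rewrite !addr0 => -> //; rewrite undiffE//.
by case: ifP; lia.
Qed.

Lemma cell_poly_local k w w' s s' :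
  (forall l, (l < k)%N -> w (s + l%:Z) = w' (s' + l%:Z)) ->
  cell_poly k w s = cell_poly k w' s'.
Proof.
move=> ww'; congr (_^`()%R); apply: eq_bigr => n _; congr (_ *: _).
apply: eq_bigr => l _; apply: ww'.
by rewrite (leq_trans (ltn_ord l))// -ltnS.
Qed.

(** Needed because a numerical entropy flux is a function of finitely many states. *)
Lemma recon_local k w w' m m' : (1 < k)%N ->
  (forall a : int, - k%:Z < a < k%:Z -> w (m + a) = w' (m' + a)) ->
  recon_right k w m = recon_right k w' m' /\ recon_left k w m = recon_left k w' m'.
Proof.
move=> k1 ww'; have := ww' 0; rewrite !addr0 => w0.
rewrite /recon_right /recon_left; case: eqP => k2.
  by rewrite /minmod_slope !ww' ?w0 //; lia.
have startE : eno_start k.-1 w m - m = eno_start k.-1 w' m' - m'.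
  by apply: eno_start_local => a ak; apply: ww'; lia.
have /= := eno_start_bounds k.-1 w m.
move: (eno_start _ w m) (eno_start _ w' m') startE => s s' startE ms.
have -> : m' - s' = m - s by lia.
rewrite (cell_poly_local k w w' s s')// => l lk.
have := ww' (s + l%:Z - m); rewrite [X in w X]addrC subrK => ->; last by lia.
by congr w'; lia.
Qed.

End Locality.

(** * Entropy fluxes and the discrete entropy inequality in one direction *)

Section Flux.
Context {R : realType}.
Local Notation state := 'cV[R]_6.
Implicit Types (u : int -> state) (V F A B : state) (i : int) (k : nat).

Definition dot {n} (x y : 'cV[R]_n) : R := (x^T *m y) 0 0.

Lemma dotE n (x y : 'cV[R]_n) : dot x y = \sum_i x i 0 * y i 0.
Proof. by rewrite /dot mxE; under eq_bigr do rewrite mxE. Qed.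

Lemma dotDl n (x y z : 'cV[R]_n) : dot (x + y) z = dot x z + dot y z.
Proof. by rewrite /dot linearD mulmxDl mxE. Qed.

Lemma dotBl n (x y z : 'cV[R]_n) : dot (x - y) z = dot x z - dot y z.
Proof. by rewrite /dot linearB mulmxBl !mxE. Qed.

Lemma dotDr n (x y z : 'cV[R]_n) : dot x (y + z) = dot x y + dot x z.
Proof. by rewrite /dot mulmxDr mxE. Qed.

Lemma dotBr n (x y z : 'cV[R]_n) : dot x (y - z) = dot x y - dot x z.
Proof. by rewrite /dot mulmxBr !mxE. Qed.

Lemma dotZr n a (x y : 'cV[R]_n) : dot x (a *: y) = a * dot x y.
Proof. by rewrite /dot -scalemxAr mxE. Qed.

Lemma dotNr n (x y : 'cV[R]_n) : dot x (- y) = - dot x y.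
Proof. by rewrite /dot mulmxN mxE. Qed.

Lemma dot_mulmxr n (M : 'M[R]_n) (x y : 'cV[R]_n) : dot x (M *m y) = dot (M^T *m x) y.
Proof. by rewrite /dot trmx_mul trmxK mulmxA. Qed.

(** The right side exceeds the left by a quarter of [dot (Vr - V) Dr + dot (V - Vl) Dl]. *)
Lemma dissipative_flux_split n (Vl V Vr Fl Fr Dl Dr : 'cV[R]_n) (ql qr : R) :
  dot V (Fr - Fl) = qr - ql -> 0 <= dot (Vr - V) Dr -> 0 <= dot (V - Vl) Dl ->
  qr - 4^-1 * dot (V + Vr) Dr - (ql - 4^-1 * dot (Vl + V) Dl) <=
  dot V (Fr - 2^-1 *: Dr - (Fl - 2^-1 *: Dl)).
Proof.
rewrite !dotBl !dotDl !dotBr !dotZr.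
move: (dot V Fr) (dot V Fl) (dot V Dr) (dot V Dl) (dot Vr Dr) (dot Vl Dl).
by move=> *; lra.
Qed.

Context (ec : state -> state -> state) (Rtilde : state -> 'M[R]_6).
Context (eigenvalues : state -> seq R) (avg : state -> state -> state).
Context (psi : state -> R).

Definition dissipation k u i : state :=
  let A := primitive (avg (u i) (u (i + 1))) in
  let Rt := Rtilde A in
  let w c m := (Rt^T *m entropy_var (u m)) c 0 in
  (Rt *m Lambda (eigenvalues A) *m Rt^T) *m
  (invmx Rt^T *m \col_c recon_left k (w c) (i + 1)
   - invmx Rt^T *m \col_c recon_right k (w c) i).

Lemma es_fluxE k u i : es_flux ec Rtilde eigenvalues avg k u i =
  ec_flux ec k u i - 2^-1 *: dissipation k u i.
Proof. by []. Qed.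

(** Tadmor's two-point entropy flux, with [psi] the entropy potential. *)
Definition two_point_eflux A B : R :=
  (dot (entropy_var A + entropy_var B) (ec (primitive A) (primitive B))
   - (psi A + psi B)) / 2.

Definition ec_eflux k u i : R :=
  let f a b := two_point_eflux (u a) (u b) in
  if k == 2%N then f i (i + 1)
  else 4 / 3 * f i (i + 1) - 6^-1 * (f (i - 1) (i + 1) + f i (i + 2)).

Definition es_eflux k u i : R :=
  ec_eflux k u i
  - 4^-1 * dot (entropy_var (u i) + entropy_var (u (i + 1))) (dissipation k u i).

Lemma es_eflux_local k u u' i i' : k \in [:: 2; 3; 4]%N ->
  (forall a : int, - k%:Z < a <= k%:Z -> u (i + a) = u' (i' + a)) ->
  es_eflux k u i = es_eflux k u' i'.
Proof.
move=> k234 uu'; have k1 : (1 < k)%N by move: k234; rewrite !inE; lia.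
have u0 : u i = u' i' by have := uu' 0; rewrite !addr0; apply; lia.
have u1 : u (i + 1) = u' (i' + 1) by apply: uu'; lia.
rewrite /es_eflux /ec_eflux /dissipation u0 u1; cbv zeta.
congr (_ - _ * _); last congr (dot _ _).
  case: eqP => // k2; rewrite (uu' (- 1)) ?(uu' 2)//; lia.
congr (mulmx _ _); congr (_ - _); congr (mulmx _ _); apply/colP => c; rewrite !mxE.
  by apply: (proj2 (recon_local _ _ _ _ _ k1 _)) => a ak; rewrite -!addrA uu'//; lia.
by apply: (proj1 (recon_local _ _ _ _ _ k1 _)) => a ak; rewrite uu'//; lia.
Qed.

(** The interface is placed between the cells 0 and 1, hence the shift by [k - 1]. Only the values
    at [- k < m <= k] matter; elsewhere the absolute value and the default 0 give meaningless
    states. *)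
Definition extend_window k (f : {ffun 'I_k.*2 -> state}) (m : int) : state :=
  oapp f 0 (insub `|(m + k%:Z - 1)%R|%N).

Definition window_eflux k : num_entropy_flux R k :=
  fun f => es_eflux k (extend_window k f) 0.

Lemma at_interfaceE k u i : k \in [:: 2; 3; 4]%N ->
  at_interface (window_eflux k) u i = es_eflux k u i.
Proof.
move=> k234; apply: es_eflux_local => // a ak.
rewrite add0r /extend_window; case: insubP => [j _ jE|]; last by lia.
by rewrite /= ffunE jE; congr u; lia.
Qed.

Hypothesis ec_conservative : forall A B, admissible A -> admissible B ->
  dot (entropy_var B - entropy_var A) (ec (primitive A) (primitive B))
  = psi B - psi A.
Hypothesis Rtilde_unit : forall A, admissible A -> Rtilde (primitive A) \in unitmx.
Hypothesis avg_admissible : admissible_avg avg.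

(* With the interface matrix R, [V] . D [[V]] = lambda (R^T [V]) . [[R^T V]],
   and all terms of the latter product are nonnegative. *)
Lemma dissipation_sign k u i : k \in [:: 2; 3; 4]%N -> (forall m, admissible (u m)) ->
  0 <= dot (entropy_var (u (i + 1)) - entropy_var (u i)) (dissipation k u i).
Proof.
move=> k234 uadm; rewrite /dissipation.
set A := primitive _; set Rt := Rtilde A.
have Rt_unit : Rt^T \in unitmx.
  by rewrite unitmx_tr Rtilde_unit//; exact: avg_admissible.
rewrite -mulmxBr -mulmxA mulKVmx// /Lambda -mulmxA mul_scalar_mx -scalemxAr dotZr.
rewrite mulr_ge0//.
  by elim/big_ind: _ => // x y x0 _; rewrite le_max x0.
rewrite dot_mulmxr dotE; apply: sumr_ge0 => c _.
rewrite mulmxBr.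
have subE (x y : 'cV[R]_6) : (x - y) c 0 = x c 0 - y c 0 by rewrite !mxE.
(* Sign preservation is used with [e] the original jump of the scaled variable, so that its premise
   is a square. *)
rewrite !subE ![(\col__ _) c 0]mxE; apply: recon_sign_preserving => //.
by rewrite -expr2 sqr_ge0.
Qed.

(** The definition of the flux gives the sum of the two products, and [ec_conservative] their
    difference. *)
Lemma two_point_eflux_split A B : admissible A -> admissible B ->
  dot (entropy_var A) (ec (primitive A) (primitive B)) = two_point_eflux A B + psi A
  /\ dot (entropy_var B) (ec (primitive A) (primitive B)) = two_point_eflux A B + psi B.
Proof.
move=> Aadm Badm; have := ec_conservative _ _ Aadm Badm.
rewrite /two_point_eflux dotBl dotDl.
by move: (dot (entropy_var A) _) (dot (entropy_var B) _) => x y xy; split; lra.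
Qed.

Lemma es_eflux_stable k u i : k \in [:: 2; 3; 4]%N -> (forall m, admissible (u m)) ->
  es_eflux k u i - es_eflux k u (i - 1) <=
  dot (entropy_var (u i))
    (es_flux ec Rtilde eigenvalues avg k u i - es_flux ec Rtilde eigenvalues avg k u (i - 1)).
Proof.
move=> k234 uadm; rewrite !es_fluxE /es_eflux subrK.
have ecE : dot (entropy_var (u i)) (ec_flux ec k u i - ec_flux ec k u (i - 1)) =
    ec_eflux k u i - ec_eflux k u (i - 1).
  have split a b := two_point_eflux_split _ _ (uadm a) (uadm b).
  have [l1 _] := split i (i + 1); have [_ r1] := split (i - 1) i.
  rewrite /ec_flux /ec_eflux subrK; case: eqP => _.
    by rewrite dotBr l1 r1; lra.
  (* In fourth order the pair [(i - 1, i + 1)] occurs in both interface fluxes and cancels; every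
     remaining pair contains [i]. *)
  have [l2 _] := split i (i + 2); have [_ r2] := split (i - 2) i.
  have -> : i - 1 - 1 = i - 2 by lia.
  have -> : i - 1 + 2 = i + 1 by lia.
  by rewrite !dotBr !dotZr !dotDr l1 l2 r1 r2; lra.
apply: dissipative_flux_split => //; first exact: dissipation_sign.
by have := dissipation_sign k u (i - 1) k234 uadm; rewrite subrK.
Qed.

Lemma es_eflux_consistent k q0 : k \in [:: 2; 3; 4]%N ->
  (forall A, admissible A -> two_point_eflux A A = q0 A) ->
  consistent (window_eflux k) q0.
Proof.
move=> k234 q0E A Aadm; rewrite /window_eflux.
rewrite (_ : es_eflux _ _ _ = es_eflux k (fun=> A) 0); last first.
  apply: es_eflux_local => // a ak; rewrite add0r /extend_window.
  by case: insubP => [j _ _|]; [rewrite /= ffunE | lia].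
rewrite /es_eflux; suff -> : dissipation k (fun=> A) 0 = 0.
  rewrite /dot mulmx0 mxE mulr0 subr0 /ec_eflux q0E//.
  by case: ifP => // _; lra.
rewrite /dissipation -mulmxBr (_ : _ - _ = 0) ?mulmx0//.
apply/colP => c; rewrite !mxE.
(* The original jump is zero, so sign preservation with [e = -1] and [e = 1] forces the
   reconstructed jump to vanish. *)
set w := (fun _ => _ : R); apply/eqP; rewrite eq_le; apply/andP; split.
  rewrite -oppr_ge0 -mulN1r; apply: (recon_sign_preserving k w 0) => //.
  by rewrite /w subrr mulr0.
rewrite -[X in _ <= X]mul1r; apply: (recon_sign_preserving k w 0) => //.
by rewrite /w subrr mulr0.
Qed.

End Flux.

(** * Entropy variables and two-point fluxes of the system *)

Section StateTheory.
Context {R : realType}.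
Local Notation state := 'cV[R]_6.
Implicit Types (U V W UL UR WL WR x : state).

Local Notation coord w k := (w (@Ordinal 6 k%N isT) 0).

Lemma sum6E (F : 'I_6 -> R) : \sum_i F i =
  F (@Ordinal 6 0 isT) + F (@Ordinal 6 1 isT) + F (@Ordinal 6 2 isT)
  + F (@Ordinal 6 3 isT) + F (@Ordinal 6 4 isT) + F (@Ordinal 6 5 isT).
Proof.
rewrite !big_ord_recl big_ord0 addr0 !addrA.
by do !congr (_ + _); congr F; apply: val_inj.
Qed.

Lemma dot6E U V : dot U V = coord U 0 * coord V 0 + coord U 1 * coord V 1
  + coord U 2 * coord V 2 + coord U 3 * coord V 3 + coord U 4 * coord V 4
  + coord U 5 * coord V 5.
Proof. by rewrite dotE sum6E. Qed.

Lemma col6_eqP U V : [/\ coord U 0 = coord V 0, coord U 1 = coord V 1 &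
  coord U 2 = coord V 2] -> [/\ coord U 3 = coord V 3, coord U 4 = coord V 4 &
  coord U 5 = coord V 5] -> U = V.
Proof.
move=> [? ? ?] [? ? ?]; apply/colP => -[[|[|[|[|[|[|//]]]]]] k6];
by rewrite (bool_irrelevance k6 isT).
Qed.

(** The quadratic form at (1, 0) and (0, 1) gives the diagonal entries; at (- P12, P11) it equals
    [P11 * detP]. *)
Lemma admissibleP U : admissible U ->
  [/\ 0 < depth (primitive U), 0 < P11 (primitive U), 0 < P22 (primitive U)
   & 0 < detP (primitive U)].
Proof.
move=> [h0 pd]; set W := primitive U in h0 pd *.
have quad a b : (a != 0) || (b != 0) ->
    0 < P11 W * a ^+ 2 + 2 * P12 W * a * b + P22 W * b ^+ 2.
  move=> ab0; set x : 'cV[R]_2 := \col_i [:: a; b]`_i.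
  have /pd : x != 0.
    apply: contraTneq ab0 => /colP x0; have := (x0 0, x0 1).
    by rewrite !mxE /= => -[-> ->]; rewrite eqxx.
  rewrite !mxE !big_ord_recl big_ord0 !mxE !big_ord_recl !big_ord0 !mxE /=.
  rewrite -/(P11 W) -/(P12 W) -/(P22 W).
  by congr (0 < _); ring.
have p11 : 0 < P11 W.
  have := quad 1 0; rewrite oner_neq0 => /(_ isT); lra.
have p22 : 0 < P22 W.
  have := quad 0 1; rewrite oner_neq0 orbT => /(_ isT); lra.
split=> //; have := quad (- P12 W) (P11 W).
rewrite (gt_eqF p11) orbT => /(_ isT) d0.
rewrite -(pmulr_rgt0 _ p11) /detP; move: d0; congr (0 < _); ring.
Qed.

(** The closed form of [entropy_var] in primitive variables, established in [entropy_varE]. The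
    factor 4 arises because E12 stands for both off-diagonal entries. *)
Definition entropy_var_expl W : state :=
  let v1 := vel1 W in let v2 := vel2 W in
  col6 [:: 4 - ln (detP W / depth W ^+ 2)
             - (beta22 W * v1 ^+ 2 - 2 * beta12 W * v1 * v2 + beta11 W * v2 ^+ 2);
          2 * (beta22 W * v1 - beta12 W * v2);
          2 * (beta11 W * v2 - beta12 W * v1);
          - 2 * beta22 W; 4 * beta12 W; - 2 * beta11 W].

(** [Bx] is the image of a pure change of velocity at fixed depth and stress, on which the entropy
    does not depend. The same holds for [By]. *)
Lemma dot_entropy_var_Bx g W : dot (entropy_var_expl W) (Bx g W) = 0.
Proof. by rewrite dot6E !mxE /=; field. Qed.

Lemma dot_entropy_var_By g W : dot (entropy_var_expl W) (By g W) = 0.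
Proof. by rewrite dot6E !mxE /=; field. Qed.

Lemma logmean_jump (f : state -> R) WL WR : 0 < f WL -> 0 < f WR ->
  logmean f WL WR * (ln (f WR) - ln (f WL)) = f WR - f WL
  /\ (f WR - f WL) / logmean f WL WR = ln (f WR) - ln (f WL).
Proof.
move=> fL fR; rewrite /logmean; case: eqP => [->|/eqP fLR].
  by rewrite !subrr mulr0 mul0r.
have lnLR : ln (f WR) - ln (f WL) != 0.
  by rewrite subr_eq0 eq_sym; apply: contra_neq fLR; apply: ln_inj.
have fRL : f WR - f WL != 0 by rewrite subr_eq0 eq_sym.
by split; field; rewrite ?lnLR ?fRL.
Qed.

Lemma Dbeta_inv W : detP W != 0 -> Dbeta W = (detP W)^-1.
Proof.
by move=> D0; rewrite /Dbeta /beta11 /beta12 /beta22 -[RHS]mul1r -(mulfV D0) /detP; field.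
Qed.

(** Splits the specific entropy into the two logarithms whose jumps the logarithmic means
    convert. *)
Lemma ln_spec_entropy W : 0 < depth W -> 0 < detP W ->
  ln (detP W / depth W ^+ 2) = - ln (Dbeta W) - 2 * ln (depth W).
Proof.
move=> h0 D0; rewrite Dbeta_inv ?gt_eqF// ln_div ?posrE// ?exprn_gt0//.
by rewrite lnV ?posrE// lnXn// mulr_natl opprK.
Qed.

Lemma Delta_beta_gt0 UL UR : admissible UL -> admissible UR ->
  0 < Delta_beta (primitive UL) (primitive UR).
Proof.
have beta U : admissible U -> let W := primitive U in
    [/\ 0 < beta11 W, 0 < beta22 W & 0 < beta11 W * beta22 W - beta12 W ^+ 2].
  move=> /admissibleP[_ p11 p22 D0] W; rewrite !divr_gt0//; split=> //.
  by rewrite -/(Dbeta W) Dbeta_inv ?invr_gt0// gt_eqF.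
move=> /beta[a1 b1 d1] /beta[a2 b2 d2]; rewrite /Delta_beta /mean.
move: (beta11 (primitive UL)) (beta22 (primitive UL)) (beta12 (primitive UL))
  (beta11 (primitive UR)) (beta22 (primitive UR)) (beta12 (primitive UR))
  a1 b1 d1 a2 b2 d2 => a1 b1 c1 a2 b2 c2 a1p b1p d1 a2p b2p d2.
(* Multiplying by a1 a2 turns the polarised determinant into a square plus
   the two determinants. *)
have a12 : 0 < a1 * a2 by rewrite mulr_gt0.
suff : 0 < a1 * b2 + a2 * b1 - 2 * c1 * c2 by lra.
rewrite -(pmulr_rgt0 _ a12).
have -> : a1 * a2 * (a1 * b2 + a2 * b1 - 2 * c1 * c2) =
  a1 ^+ 2 * (a2 * b2 - c2 ^+ 2) + a2 ^+ 2 * (a1 * b1 - c1 ^+ 2)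
  + (a1 * c2 - a2 * c1) ^+ 2 by ring.
by rewrite ltr_wpDr ?sqr_ge0// addr_gt0// mulr_gt0// exprn_gt0.
Qed.

(* The discrete product rule [a b] = mean a [b] + [a] mean b removes everything
   but the jumps of ln h and of the velocity. *)
Lemma dot_jump_ec_complete UL UR (f1 c1 c2 : R) : admissible UL -> admissible UR ->
  let WL := primitive UL in let WR := primitive UR in
  dot (entropy_var_expl WR - entropy_var_expl WL)
    (ec_complete WL WR f1 (mean (@vel1 R) WL WR * f1 + c1)
                          (mean (@vel2 R) WL WR * f1 + c2))
  = 2 * (ln (depth WR) - ln (depth WL)) * f1
  + 2 * (mean (@beta22 R) WL WR * c1 - mean (@beta12 R) WL WR * c2)
      * (vel1 WR - vel1 WL)
  + 2 * (mean (@beta11 R) WL WR * c2 - mean (@beta12 R) WL WR * c1)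
      * (vel2 WR - vel2 WL).
Proof.
move=> Ladm Radm WL WR.
have [hL _ _ DL] := admissibleP _ Ladm; have [hR _ _ DR] := admissibleP _ Radm.
rewrite -/WL -/WR in hL DL hR DR.
have DbL : 0 < Dbeta WL by rewrite Dbeta_inv ?invr_gt0// gt_eqF.
have DbR : 0 < Dbeta WR by rewrite Dbeta_inv ?invr_gt0// gt_eqF.
rewrite dot6E !mxE /= !ln_spec_entropy//.
have [_] := logmean_jump (@Dbeta R) WL WR DbL DbR.
move: (logmean (@Dbeta R) WL WR)^-1 (ln (Dbeta WR)) (ln (Dbeta WL)) => k lR lL.
(* The jump of [ln Dbeta] is replaced by [k] times that of [Dbeta], which leaves an algebraic
   identity. *)
move=> /esym/eqP; rewrite subr_eq => /eqP->.
rewrite /Dbeta /mean; move: (ln (depth WR)) (ln (depth WL)) => lhR lhL.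
move: (vel1 WL) (vel1 WR) (vel2 WL) (vel2 WR) (beta11 WL) (beta11 WR)
  (beta12 WL) (beta12 WR) (beta22 WL) (beta22 WR) => a b c d e f x y z t.
by field.
Qed.

(** The stress corrections solve a linear system of determinant [Delta_beta]: the jump of [vel1]
    gets twice the mean depth as coefficient and that of [vel2] gets zero. The product rule for the
    jump of [h v1] concludes. *)
Lemma ec_x_conservative UL UR : admissible UL -> admissible UR ->
  let WL := primitive UL in let WR := primitive UR in
  dot (entropy_var_expl WR - entropy_var_expl WL) (ec_x WL WR)
  = 2 * depth WR * vel1 WR - 2 * depth WL * vel1 WL.
Proof.
move=> Ladm Radm WL WR; rewrite dot_jump_ec_complete//.
have := Delta_beta_gt0 _ _ Ladm Radm; rewrite -/WL -/WR => /lt0r_neq0 Delta0.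
have [h0L _ _ _] := admissibleP _ Ladm; have [h0R _ _ _] := admissibleP _ Radm.
have [jh _] := logmean_jump (@depth R) WL WR h0L h0R.
rewrite [X in X + _ + _](_ : _ = 2 * (depth WR - depth WL) * mean (@vel1 R) WL WR).
  move: Delta0; rewrite /Delta_beta.
  move: (mean (@beta11 R) _ _) (mean (@beta12 R) _ _) (mean (@beta22 R) _ _) => a b c Delta0.
  by rewrite /mean; field.
by rewrite -jh; ring.
Qed.

Lemma ec_y_conservative UL UR : admissible UL -> admissible UR ->
  let WL := primitive UL in let WR := primitive UR in
  dot (entropy_var_expl WR - entropy_var_expl WL) (ec_y WL WR)
  = 2 * depth WR * vel2 WR - 2 * depth WL * vel2 WL.
Proof.
move=> Ladm Radm WL WR; rewrite dot_jump_ec_complete//.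
have := Delta_beta_gt0 _ _ Ladm Radm; rewrite -/WL -/WR => /lt0r_neq0 Delta0.
have [h0L _ _ _] := admissibleP _ Ladm; have [h0R _ _ _] := admissibleP _ Radm.
have [jh _] := logmean_jump (@depth R) WL WR h0L h0R.
rewrite [X in X + _ + _](_ : _ = 2 * (depth WR - depth WL) * mean (@vel2 R) WL WR).
  move: Delta0; rewrite /Delta_beta.
  move: (mean (@beta11 R) _ _) (mean (@beta12 R) _ _) (mean (@beta22 R) _ _) => a b c Delta0.
  by rewrite /mean; field.
by rewrite -jh; ring.
Qed.

Lemma meanxx (f : state -> R) W : mean f W W = f W.
Proof. by rewrite /mean; field. Qed.

Lemma logmeanxx (f : state -> R) W : logmean f W W = f W.
Proof. by rewrite /logmean eqxx. Qed.

(** [c1] and [c2] enter as a change of velocity, so they drop out like the nonconservative terms;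
    the trace of beta times its inverse lowers the constant 4 to 2. *)
Lemma dot_ec_completexx W (f1 c1 c2 : R) : Dbeta W != 0 ->
  dot (entropy_var_expl W) (ec_complete W W f1 (vel1 W * f1 + c1) (vel2 W * f1 + c2))
  = (2 - ln (detP W / depth W ^+ 2)) * f1.
Proof.
rewrite dot6E !mxE /= !meanxx !logmeanxx /Dbeta; move: (ln _) => l Db0.
by field.
Qed.

Lemma ec_x_consistent U : admissible U -> let W := primitive U in
  dot (entropy_var_expl W) (ec_x W W) - 2 * depth W * vel1 W = qx U.
Proof.
move=> /admissibleP[_ _ _ D0] W.
rewrite /ec_x !meanxx logmeanxx dot_ec_completexx.
  by rewrite /qx /spec_entropy -/W; ring.
by rewrite Dbeta_inv ?invr_eq0 gt_eqF.
Qed.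

Lemma ec_y_consistent U : admissible U -> let W := primitive U in
  dot (entropy_var_expl W) (ec_y W W) - 2 * depth W * vel2 W = qy U.
Proof.
move=> /admissibleP[_ _ _ D0] W.
rewrite /ec_y !meanxx logmeanxx dot_ec_completexx.
  by rewrite /qy /spec_entropy -/W; ring.
by rewrite Dbeta_inv ?invr_eq0 gt_eqF.
Qed.

End StateTheory.

(** * Differentiation of the entropy *)

Section EntropyGradient.
Context {R : realType}.
Local Notation state := 'cV[R]_6.
Local Notation coord w k := (w (@Ordinal 6 k%N isT) 0).

Lemma entropyE (U : state) : entropy U = - coord U 0 * ln (
  ((2 * coord U 3 / coord U 0 - coord U 1 / coord U 0 * (coord U 1 / coord U 0))
   * (2 * coord U 5 / coord U 0 - coord U 2 / coord U 0 * (coord U 2 / coord U 0))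
   - (2 * coord U 4 / coord U 0 - coord U 1 / coord U 0 * (coord U 2 / coord U 0)) ^+ 2)
  / coord U 0 ^+ 2).
Proof. by rewrite /entropy /spec_entropy /detP /depth /P11 /P22 /P12 !mxE. Qed.

Lemma is_derive_coord {V : normedModType R} {f : V -> state} {t v df} k :
  is_derive t v f df -> is_derive t v (fun s => f s k 0) (df k 0).
Proof.
move=> [ftv <-]; apply: DeriveDef; first by move/derivable_mxP : ftv.
by rewrite derive_mx// mxE.
Qed.

(** The differentiation rules are restated for explicit [fun s => ...], so that nested applications
    differentiate a formula as written. *)
Lemma is_derive_add {V : normedModType R} {f g : V -> R} {t v : V} {df dg : R} :
  is_derive t v f df -> is_derive t v g dg -> is_derive t v (fun s => f s + g s) (df + dg).
Proof. exact: is_deriveD. Qed.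

Lemma is_derive_sub {V : normedModType R} {f g : V -> R} {t v : V} {df dg : R} :
  is_derive t v f df -> is_derive t v g dg -> is_derive t v (fun s => f s - g s) (df - dg).
Proof. exact: is_deriveB. Qed.

Lemma is_derive_mul {V : normedModType R} {f g : V -> R} {t v : V} {df dg : R} :
  is_derive t v f df -> is_derive t v g dg ->
  is_derive t v (fun s => f s * g s) (f t * dg + g t * df).
Proof. exact: is_deriveM. Qed.

Lemma is_derive_scale {V : normedModType R} (a : R) {f : V -> R} {t v : V} {df : R} :
  is_derive t v f df -> is_derive t v (fun s => a * f s) (a * df).
Proof. exact: is_deriveZ. Qed.

Lemma is_derive_opp {V : normedModType R} {f : V -> R} {t v : V} {df : R} :
  is_derive t v f df -> is_derive t v (fun s => - f s) (- df).
Proof. exact: is_deriveN. Qed.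

Lemma is_derive_inv {f : R -> R} {t v df : R} :
  f t != 0 -> is_derive t v f df -> is_derive t v (fun s => (f s)^-1) (- f t ^- 2 * df).
Proof. exact: is_deriveV. Qed.

Lemma is_derive_log {f : R -> R} {t df : R} : 0 < f t -> is_derive t 1 f df ->
  is_derive t 1 (fun s => ln (f s)) ((f t)^-1 * df).
Proof. by move=> f0; apply: is_derive1_comp; apply: is_derive1_ln. Qed.

(** The chain rule along a curve serves twice: along coordinate lines for the gradient, and along a
    solution for the time derivative. *)
Lemma is_derive_entropy (c : R -> state) (t : R) : derivable c t 1 -> admissible (c t) ->
  is_derive t 1 (fun s => entropy (c s))
    (dot (entropy_var_expl (primitive (c t))) ('D_1 c t)).
Proof.
move=> dc adm; have [h0 _ _ D0] := admissibleP _ adm.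
have dck k := is_derive_coord k (derivableP dc).
move: (dck (@Ordinal 6 0 isT)) (dck (@Ordinal 6 1 isT)) (dck (@Ordinal 6 2 isT))
  (dck (@Ordinal 6 3 isT)) (dck (@Ordinal 6 4 isT)) (dck (@Ordinal 6 5 isT)).
move=> d0 d1 d2 d3 d4 d5.
under eq_fun do rewrite entropyE.
have h0' : coord (c t) 0 != 0 by move: h0; rewrite /depth mxE => /lt0r_neq0.
have dinv := is_derive_inv h0' d0.
have stress_entry (e a b : R -> R) (de da db : R)
    (De : is_derive t 1 e de) (Da : is_derive t 1 a da) (Db : is_derive t 1 b db) :=
  is_derive_sub (is_derive_mul (is_derive_scale 2 De) dinv)
    (is_derive_mul (is_derive_mul Da dinv) (is_derive_mul Db dinv)).
have D11 := stress_entry _ _ _ _ _ _ d3 d1 d1.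
have D12 := stress_entry _ _ _ _ _ _ d4 d1 d2.
have D22 := stress_entry _ _ _ _ _ _ d5 d2 d2.
(* Squares are differentiated as products, to which [^+ 2] reduces. *)
have Ddet := is_derive_sub (is_derive_mul D11 D22) (is_derive_mul D12 D12).
have h20 : coord (c t) 0 * coord (c t) 0 != 0 by rewrite mulf_neq0.
have Darg := is_derive_mul Ddet (is_derive_inv (f := fun s => coord (c s) 0 * coord (c s) 0) h20
  (is_derive_mul d0 d0)).
apply: is_derive_eq.
  apply: is_derive_mul (is_derive_opp d0) (is_derive_log _ Darg).
  move: D0 (exprn_gt0 2 h0); rewrite /detP /depth /P11 /P12 /P22 !mxE /=.
  exact: divr_gt0.
move: D0; clear - h0'; move: ('D_1 c t) h0' => dc; move: (c t) => u h0'.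
rewrite dot6E /entropy_var_expl /beta11 /beta12 /beta22 /detP /depth /P11 /P12 /P22.
rewrite /vel1 /vel2 !mxE /=; move: (ln _) => l.
set p11 := 2 * coord u 3 / coord u 0 - _; set p12 := 2 * coord u 4 / coord u 0 - _.
set p22 := 2 * coord u 5 / coord u 0 - _ => /lt0r_neq0 D0.
(* The energies are rewritten through the stresses, so that the determinant appears in the form that
   [D0] makes nonzero. *)
have -> : coord u 3 = coord u 0 / 2 * (p11 + coord u 1 / coord u 0 * (coord u 1 / coord u 0)).
  by rewrite /p11; field.
have -> : coord u 4 = coord u 0 / 2 * (p12 + coord u 1 / coord u 0 * (coord u 2 / coord u 0)).
  by rewrite /p12; field.
have -> : coord u 5 = coord u 0 / 2 * (p22 + coord u 2 / coord u 0 * (coord u 2 / coord u 0)).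
  by rewrite /p22; field.
move: p11 p12 p22 D0 => p11 p12 p22 D0.
by field; rewrite h0' D0.
Qed.

(** Reduces the partial derivatives in [entropy_var] to derivatives in one real variable. *)
Lemma derive_along_line (V W : normedModType R) (f : V -> W) a v :
  'D_v f a = 'D_1 (fun s : R => f (s *: v + a)) 0.
Proof.
rewrite /derive.
suff -> : (fun h : R => h^-1 *: ((f \o shift a) (h *: v) - f a)) =
  (fun h : R => h^-1 *: (((fun s : R => f (s *: v + a)) \o shift 0) (h *: 1)
                          - f (0 *: v + a))) by [].
by apply/funext => h /=; rewrite scale0r add0r addr0 [_ *: 1]mulr1.
Qed.

Lemma is_derive_line (V : normedModType R) (a v : V) :
  is_derive (0 : R) 1 (fun s : R => s *: v + a) v.
Proof.
have line_cvg : h^-1 *: (((fun s : R => s *: v + a) \o shift 0) (h *: 1) - (0 *: v + a))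
    @[h --> (0 : R)^'] --> v.
  apply: cvg_near_cst; near=> h => /=.
  rewrite scale0r add0r addr0 [_ *: 1]mulr1 addrK scalerA mulVf ?scale1r//.
  by near: h; exact: nbhs_dnbhs_neq.
by apply: DeriveDef; [apply/cvg_ex; exists v | exact: cvg_lim].
Unshelve. all: by end_near. Qed.

Lemma entropy_varE (U : state) : admissible U -> entropy_var U = entropy_var_expl (primitive U).
Proof.
move=> Uadm; apply/colP => k; rewrite mxE derive_along_line.
have [dl dlE] := is_derive_line state U (delta_mx k 0).
have := is_derive_entropy (fun s => s *: delta_mx k 0 + U) 0 dl.
rewrite scale0r add0r dlE => /(_ Uadm)[_ ->].
rewrite dotE (bigD1 k)//= big1 ?addr0 => [|j jk]; last by rewrite !mxE (negPf jk) mulr0.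
by rewrite [X in _ * X]mxE !eqxx mulr1.
Qed.

End EntropyGradient.

(** * Invertibility of the scaled eigenvector matrices *)

Section Invertibility.
Context {R : realType}.
Local Notation state := 'cV[R]_6.
Local Notation coord w k := (w (@Ordinal 6 k%N isT) 0).
Implicit Types (U W x : state).

Lemma unitmx_kernel n (A : 'M[R]_n) :
  (forall x : 'cV[R]_n, A *m x = 0 -> x = 0) -> A \in unitmx.
Proof.
move=> kerA; rewrite -unitmx_tr -row_free_unit; apply/inj_row_free => v vA.
by apply: trmx_inj; rewrite trmx0; apply: kerA; rewrite -[A]trmxK -trmx_mul vA trmx0.
Qed.

Lemma mulmx_rows6 (rows : seq (seq R)) x (k : 'I_6) :
  (mx_of_rows 6 6 rows *m x) k 0 = let r := nth [::] rows k in
  r`_0 * coord x 0 + r`_1 * coord x 1 + r`_2 * coord x 2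
  + r`_3 * coord x 3 + r`_4 * coord x 4 + r`_5 * coord x 5.
Proof.
by rewrite mxE sum6E !mxE.
Qed.

(* The eigenvectors are paired by the reflection of the normal velocity, so the
   system decouples into sums and differences of the paired coefficients. *)
Lemma eigenvector_kernel (h p q r r3 : R) x : h != 0 -> p != 0 -> r != 0 -> r3 != 0 ->
  h * p * coord x 0 - h * coord x 2 + h * p * coord x 5 = 0 ->
  r3 * p * (coord x 5 - coord x 0) = 0 ->
  r3 * q * (coord x 5 - coord x 0) + r * (coord x 4 - coord x 1) = 0 ->
  2 * p ^+ 2 * coord x 0 + p * coord x 2 + 2 * p ^+ 2 * coord x 5 = 0 ->
  2 * p * q * coord x 0 + p * coord x 1 + q * coord x 2 + p * coord x 4
    + 2 * p * q * coord x 5 = 0 ->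
  2 * q ^+ 2 * coord x 0 + 2 * q * coord x 1 + coord x 3 + 2 * q * coord x 4
    + 2 * q ^+ 2 * coord x 5 = 0 ->
  x = 0.
Proof.
move=> h0 p0 r0 r30 e0 e1 e2 e3 e4 e5.
have x5 : coord x 5 = coord x 0.
  by apply/eqP; rewrite -subr_eq0; move/eqP: e1; rewrite !mulf_eq0 (negPf r30) (negPf p0).
have x4 : coord x 4 = coord x 1.
  move/eqP: e2; rewrite x5 subrr mulr0 add0r mulf_eq0 (negPf r0) /=.
  by rewrite subr_eq0 => /eqP.
have x2 : coord x 2 = 2 * p * coord x 0.
  by apply: (mulfI h0); rewrite x5 in e0; lra.
have x0 : coord x 0 = 0.
  apply: (mulfI p0); apply: (mulfI p0); rewrite x5 x2 in e3; lra.
have {}x2 : coord x 2 = 0 by rewrite x2 x0 mulr0.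
have x1 : coord x 1 = 0.
  by apply: (mulfI p0); rewrite x5 x4 x2 x0 in e4; lra.
have x3 : coord x 3 = 0 by rewrite x5 x4 x1 x0 in e5; lra.
by apply: col6_eqP; rewrite !mxE ?x5 ?x4 ?x0 ?x1 ?x2 ?x3.
Qed.

Lemma RWx_unit W : 0 < depth W -> 0 < P11 W -> RWx W \in unitmx.
Proof.
move=> h0 p0; apply: unitmx_kernel => x /colP Rx.
have row k := etrans (esym (mulmx_rows6 _ _ k)) (Rx k).
have := (row (@Ordinal 6 0 isT), row (@Ordinal 6 1 isT), row (@Ordinal 6 2 isT),
 row (@Ordinal 6 3 isT), row (@Ordinal 6 4 isT), row (@Ordinal 6 5 isT)).
rewrite !mxE /= => -[[[[[e0 e1] e2] e3] e4] e5].
have r0 : Num.sqrt (P11 W) != 0 by rewrite gt_eqF// sqrtr_gt0.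
have r30 : Num.sqrt (3 * P11 W) != 0 by rewrite gt_eqF// sqrtr_gt0 mulr_gt0.
apply: (eigenvector_kernel (depth W) (P11 W) (P12 W) _ _ x _ _ r0 r30);
  rewrite ?gt_eqF//; lra.
Qed.

Lemma RWy_unit W : 0 < depth W -> 0 < P22 W -> RWy W \in unitmx.
Proof.
move=> h0 p0; apply: unitmx_kernel => x /colP Rx.
have row k := etrans (esym (mulmx_rows6 _ _ k)) (Rx k).
have := (row (@Ordinal 6 0 isT), row (@Ordinal 6 1 isT), row (@Ordinal 6 2 isT),
 row (@Ordinal 6 3 isT), row (@Ordinal 6 4 isT), row (@Ordinal 6 5 isT)).
rewrite !mxE /= => -[[[[[e0 e1] e2] e3] e4] e5].
have r0 : Num.sqrt (P22 W) != 0 by rewrite gt_eqF// sqrtr_gt0.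
have r30 : Num.sqrt (3 * P22 W) != 0 by rewrite gt_eqF// sqrtr_gt0 mulr_gt0.
apply: (eigenvector_kernel (depth W) (P22 W) (P12 W) _ _ x _ _ r0 r30);
  rewrite ?gt_eqF//; lra.
Qed.

(** * Square roots of positive definite matrices *)

Lemma mulmx_ext m n (A B : 'M[R]_(m, n)) :
  (forall x : 'cV[R]_n, A *m x = B *m x) -> A = B.
Proof.
move=> AB; apply/matrixP => i j; have /colP/(_ i) := AB (delta_mx j 0).
by rewrite -!colE !mxE.
Qed.

Lemma posdef_unit n (A : 'M[R]_n) : posdef A -> A \in unitmx.
Proof.
move=> pdA; apply: unitmx_kernel => x Ax; apply/eqP/contraT => /pdA.
by rewrite -mulmxA Ax mulmx0 mxE ltxx.
Qed.

(** By [(m1 + d) ^ 2 + c ^ 2 = m1 * t ^ 2], this is one row of the square of [(M + d) / t] for a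
    symmetric 2x2 block M; exchanging [m1] and [m2] gives the other. *)
Lemma sqrt_row (m1 m2 c d t y z : R) : t != 0 ->
  d ^+ 2 = m1 * m2 - c ^+ 2 -> t ^+ 2 = m1 + m2 + 2 * d ->
  (m1 + d) / t * ((m1 + d) / t * y + c / t * z) + c / t * (c / t * y + (m2 + d) / t * z)
  = m1 * y + c * z.
Proof.
move=> t0 dd tt.
have diag : (m1 + d) ^+ 2 + c ^+ 2 = m1 * t ^+ 2 by rewrite tt sqrrD dd; ring.
transitivity ((((m1 + d) ^+ 2 + c ^+ 2) * y + c * (m1 + m2 + 2 * d) * z) / t ^+ 2).
  by field.
by rewrite diag -tt; field.
Qed.

(** [spd_sqrt] is a choice, so its properties follow only once a root is exhibited. The witness is
    diagonal except for one 2x2 block. *)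
Lemma Ymx_sqrt W (p : R) : 0 < depth W -> 0 < p -> 0 < detP W ->
  exists T : 'M[R]_6, [/\ T^T = T, posdef T & T *m T = Ymx W p].
Proof.
move=> h0 p0 D0.
pose a := Num.sqrt (12 * depth W * p ^+ 2)^-1.
pose b := Num.sqrt (detP W / (4 * depth W * p ^+ 2)).
pose c := P12 W ^+ 2 / (3 * depth W * p).
pose m1 := (3 * depth W)^-1.
pose m2 := (3 * detP W ^+ 2 + P12 W ^+ 4) / (3 * depth W * p ^+ 2).
(* By Cayley-Hamilton, (M + d) / t is a square root of the 2x2 block M when
   d ^ 2 = det M and t ^ 2 = tr M + 2 d. *)
pose d := Num.sqrt (m1 * m2 - c ^+ 2).
pose t := Num.sqrt (m1 + m2 + 2 * d).
have det0 : 0 < m1 * m2 - c ^+ 2.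
  have -> : m1 * m2 - c ^+ 2 = detP W ^+ 2 / (3 * depth W ^+ 2 * p ^+ 2).
    by rewrite /m1 /m2 /c; field; rewrite !gt_eqF.
  by rewrite divr_gt0 ?mulr_gt0 ?exprn_gt0.
have a0 : 0 < a by rewrite sqrtr_gt0 invr_gt0 !mulr_gt0 ?exprn_gt0.
have b0 : 0 < b by rewrite sqrtr_gt0 divr_gt0// !mulr_gt0 ?exprn_gt0.
have d0 : 0 < d by rewrite sqrtr_gt0.
have m10 : 0 < m1 by rewrite invr_gt0 mulr_gt0.
have m20 : 0 < m2.
  by rewrite divr_gt0 ?mulr_gt0 ?exprn_gt0// ltr_pwDl ?mulr_gt0 ?exprn_gt0// exprn_even_ge0.
have t0 : 0 < t by rewrite sqrtr_gt0; lra.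
exists (mx_of_rows 6 6
  [:: [:: a; 0; 0; 0; 0; 0]; [:: 0; b; 0; 0; 0; 0];
      [:: 0; 0; (m1 + d) / t; c / t; 0; 0]; [:: 0; 0; c / t; (m2 + d) / t; 0; 0];
      [:: 0; 0; 0; 0; b; 0]; [:: 0; 0; 0; 0; 0; a]]).
set T := mx_of_rows _ _ _.
have TE x : T *m x = col6 [:: a * coord x 0; b * coord x 1;
    (m1 + d) / t * coord x 2 + c / t * coord x 3;
    c / t * coord x 2 + (m2 + d) / t * coord x 3; b * coord x 4; a * coord x 5].
  by apply: col6_eqP; rewrite !mulmx_rows6 /= !mxE /=; split; ring.
split.
- apply/matrixP => i j; rewrite !mxE.
  by case: i => [[|[|[|[|[|[|//]]]]]] ?]; case: j => [[|[|[|[|[|[|//]]]]]] ?].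
- move=> x x0; rewrite -mulmxA TE.
  rewrite -[(_ *m _) 0 0]/(dot x _) dot6E !mxE /=.
  rewrite ltNge; apply: contraNN x0 => Q0.
  (* The block of [T] contributes this form divided by [t], plus [d / t] times the two squares,
     which make the total strictly positive. *)
  have block0 : 0 <= m1 * coord x 2 ^+ 2 + 2 * c * coord x 2 * coord x 3
      + m2 * coord x 3 ^+ 2.
    rewrite -(pmulr_rge0 _ m10).
    have -> : m1 * (m1 * coord x 2 ^+ 2 + 2 * c * coord x 2 * coord x 3
        + m2 * coord x 3 ^+ 2) = (m1 * coord x 2 + c * coord x 3) ^+ 2
        + (m1 * m2 - c ^+ 2) * coord x 3 ^+ 2 by ring.
    by rewrite addr_ge0 ?sqr_ge0// mulr_ge0 ?sqr_ge0// ltW.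
  have dt0 : 0 < d / t by rewrite divr_gt0.
  have {}block0 : 0 <= t^-1 * (m1 * coord x 2 ^+ 2 + 2 * c * coord x 2 * coord x 3
      + m2 * coord x 3 ^+ 2) by rewrite mulr_ge0// invr_ge0 ltW.
  have sq0 (e y : R) : 0 < e -> 0 <= e * y ^+ 2 by move=> e0; rewrite mulr_ge0 ?sqr_ge0 ?ltW.
  have eq0 (e y : R) : 0 < e -> e * y ^+ 2 <= 0 -> y = 0.
    move=> e0; rewrite pmulr_rle0// => y0; apply/eqP.
    by rewrite -sqrf_eq0 eq_le y0 sqr_ge0.
  have := (sq0 a (coord x 0) a0, sq0 b (coord x 1) b0, sq0 _ (coord x 2) dt0,
    sq0 _ (coord x 3) dt0, sq0 b (coord x 4) b0, sq0 a (coord x 5) a0).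
  move=> -[[[[[s0 s1] s2] s3] s4] s5].
  have e0 : coord x 0 = 0 by apply: (eq0 a) => //; lra.
  have e1 : coord x 1 = 0 by apply: (eq0 b) => //; lra.
  have e2 : coord x 2 = 0 by apply: (eq0 _ _ dt0) => //; lra.
  have e3 : coord x 3 = 0 by apply: (eq0 _ _ dt0) => //; lra.
  have e4 : coord x 4 = 0 by apply: (eq0 b) => //; lra.
  have e5 : coord x 5 = 0 by apply: (eq0 a) => //; lra.
  by apply/eqP; apply: col6_eqP; rewrite !mxE ?e0 ?e1 ?e2 ?e3 ?e4 ?e5.
- apply: mulmx_ext => x; rewrite -mulmxA !TE.
  have aa : a * a = (12 * depth W * p ^+ 2)^-1.
    by rewrite -expr2 sqr_sqrtr// invr_ge0 ltW// !mulr_gt0 ?exprn_gt0.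
  have bb : b * b = detP W / (4 * depth W * p ^+ 2).
    by rewrite -expr2 sqr_sqrtr// divr_ge0 ?ltW// !mulr_gt0 ?exprn_gt0.
  have dd : d ^+ 2 = m1 * m2 - c ^+ 2 by rewrite sqr_sqrtr// ltW.
  have tt : t ^+ 2 = m1 + m2 + 2 * d by rewrite sqr_sqrtr//; lra.
  have t1 : t != 0 by rewrite gt_eqF.
  have dd' : d ^+ 2 = m2 * m1 - c ^+ 2 by rewrite mulrC.
  have tt' : t ^+ 2 = m2 + m1 + 2 * d by rewrite [m2 + _]addrC.
  have row2 := sqrt_row m1 m2 c d t (coord x 2) (coord x 3) t1 dd tt.
  have row3 := sqrt_row m2 m1 c d t (coord x 3) (coord x 2) t1 dd' tt'.
  apply: col6_eqP; rewrite !mulmx_rows6 /= !mxE /= -?aa -?bb -/m1 -/m2 -/c; split; try ring.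
  + by rewrite row2; ring.
  + by rewrite addrC [X in X + _ = _]mulrDr; lra.
Qed.

Lemma spd_sqrt_unit n (Y : 'M[R]_n) :
  (exists T : 'M[R]_n, [/\ T^T = T, posdef T & T *m T = Y]) -> spd_sqrt Y \in unitmx.
Proof. by move=> /getPex[_ /posdef_unit]. Qed.

(** * The Jacobian of the conserved variables *)

Definition conserved_diff W x : state :=
  let h := depth W in let v1 := vel1 W in let v2 := vel2 W in
  let dh := coord x 0 in let dv1 := coord x 1 in let dv2 := coord x 2 in
  col6 [:: dh; h * dv1 + v1 * dh; h * dv2 + v2 * dh;
    h / 2 * (2 * v1 * dv1 + coord x 3) + (v1 * v1 + P11 W) * (dh / 2);
    h / 2 * (v1 * dv2 + v2 * dv1 + coord x 4) + (v1 * v2 + P12 W) * (dh / 2);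
    h / 2 * (2 * v2 * dv2 + coord x 5) + (v2 * v2 + P22 W) * (dh / 2)].

Lemma is_derive_conserved W x : is_derive W x (@conserved R) (conserved_diff W x).
Proof.
have dW k : is_derive W x (fun V : state => V k 0) (x k 0) := is_derive_coord k (is_derive_id W x).
have half (f : state -> R) df : is_derive W x f df ->
    is_derive W x (fun V => f V / 2) (df / 2).
  move=> fd; rewrite [df / 2]mulrC; under eq_fun do rewrite mulrC.
  exact: is_derive_scale.
have energy k a b :=
  is_derive_mul (half _ _ (dW (@Ordinal 6 0 isT)))
    (is_derive_add (is_derive_mul (dW a) (dW b)) (dW k)).
have dk (k : 'I_6) : is_derive W x (fun V => conserved V k 0) (conserved_diff W x k 0).
  under eq_fun do rewrite mxE; rewrite mxE.
  case: k => [[|[|[|[|[|[|//]]]]]] ?] /=.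
  - exact: dW.
  - exact: is_derive_mul (dW _) (dW _).
  - exact: is_derive_mul (dW _) (dW _).
  - apply: (is_derive_eq (energy (@Ordinal 6 3 isT) (@Ordinal 6 1 isT) (@Ordinal 6 1 isT))).
    by rewrite /depth /vel1 /P11; ring.
  - apply: (is_derive_eq (energy (@Ordinal 6 4 isT) (@Ordinal 6 1 isT) (@Ordinal 6 2 isT))).
    by rewrite /depth /vel1 /vel2 /P12; ring.
  - apply: (is_derive_eq (energy (@Ordinal 6 5 isT) (@Ordinal 6 2 isT) (@Ordinal 6 2 isT))).
    by rewrite /depth /vel2 /P22; ring.
have conserved_derivable : derivable (@conserved R) W x.
  by apply/derivable_mxP => i j; rewrite (ord1 j); have [] := dk i.
apply: DeriveDef => //; rewrite derive_mx//; apply/colP => i; rewrite mxE.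
by have [_] := dk i.
Qed.

Lemma jacmx_conserved W x : jacmx (@conserved R) W *m x = conserved_diff W x.
Proof.
have jacE i j : jacmx (@conserved R) W i j = conserved_diff W (delta_mx j 0) i 0.
  by rewrite mxE; have [_ ->] := is_derive_conserved W (delta_mx j 0).
apply/colP => i; rewrite mxE sum6E !jacE !mxE.
by case: i => [[|[|[|[|[|[|//]]]]]] ?] /=; rewrite ?mxE /=; field.
Qed.

(** The Jacobian is triangular with diagonal 1, h, h, h/2, h/2, h/2, so a kernel vector vanishes one
    component after another. *)
Lemma jacmx_conserved_unit W : depth W != 0 -> jacmx (@conserved R) W \in unitmx.
Proof.
move=> h0; apply: unitmx_kernel => x; rewrite jacmx_conserved => /colP dx0.
have := (dx0 (@Ordinal 6 0 isT), dx0 (@Ordinal 6 1 isT), dx0 (@Ordinal 6 2 isT),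
 dx0 (@Ordinal 6 3 isT), dx0 (@Ordinal 6 4 isT), dx0 (@Ordinal 6 5 isT)).
rewrite !mxE /= => -[[[[[x0 e1] e2] e3] e4] e5].
have x1 : coord x 1 = 0 by apply: (mulfI h0); rewrite x0 in e1; lra.
have x2 : coord x 2 = 0 by apply: (mulfI h0); rewrite x0 in e2; lra.
have x3 : coord x 3 = 0 by apply: (mulfI h0); rewrite x0 x1 in e3; lra.
have x4 : coord x 4 = 0 by apply: (mulfI h0); rewrite x0 x1 x2 in e4; lra.
have x5 : coord x 5 = 0 by apply: (mulfI h0); rewrite x0 x2 in e5; lra.
by apply: col6_eqP; rewrite !mxE ?x0 ?x1 ?x2 ?x3 ?x4 ?x5.
Qed.

Lemma Rtilde_x_unit U : admissible U -> Rtilde_x (primitive U) \in unitmx.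
Proof.
move=> /admissibleP[h0 p0 _ D0]; rewrite !unitmx_mul RWx_unit//.
by rewrite jacmx_conserved_unit ?gt_eqF//= spd_sqrt_unit//; exact: Ymx_sqrt.
Qed.

Lemma Rtilde_y_unit U : admissible U -> Rtilde_y (primitive U) \in unitmx.
Proof.
move=> /admissibleP[h0 _ p0 D0]; rewrite !unitmx_mul RWy_unit//.
by rewrite jacmx_conserved_unit ?gt_eqF//= spd_sqrt_unit//; exact: Ymx_sqrt.
Qed.

End Invertibility.

(** * Entropy inequality for the full scheme *)

Lemma entropy_decay (R : realType) n (V dU Fx Fy Bx By : 'cV[R]_n) (dx dy hx hy qx qy : R) :
  0 < dx -> 0 < dy -> dot V Bx = 0 -> dot V By = 0 ->
  qx <= dot V Fx -> qy <= dot V Fy ->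
  dU + (dx^-1 *: Fx + dy^-1 *: Fy + hx *: Bx + hy *: By) = 0 ->
  dot V dU + dx^-1 * qx + dy^-1 * qy <= 0.
Proof.
move=> dx0 dy0 VBx VBy qxF qyF /eqP; rewrite addr_eq0 => /eqP ->.
(* Pairing with [V] removes the nonconservative terms for any values of the difference quotients
   [hx] and [hy]. *)
rewrite dotNr !dotDr !dotZr VBx VBy !mulr0 !addr0.
have : dx^-1 * qx <= dx^-1 * dot V Fx by rewrite ler_wpM2l// invr_ge0 ltW.
have : dy^-1 * qy <= dy^-1 * dot V Fy by rewrite ler_wpM2l// invr_ge0 ltW.
move: (dot V Fx) (dot V Fy) => a b; lra.
Qed.

Theorem theorem2 (R : realType) (g dx dy : R)
    (avgx avgy : 'cV[R]_6 -> 'cV[R]_6 -> 'cV[R]_6) (k : nat)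
    (hg : 0 < g) (hdx : 0 < dx) (hdy : 0 < dy)
    (havgx : admissible_avg avgx) (havgy : admissible_avg avgy)
    (hk : k \in [:: 2; 3; 4]%N) :
  exists qhx qhy : num_entropy_flux R k,
    [/\ consistent qhx (@qx R), consistent qhy (@qy R) &
      forall (J : set R) (G : set (int * int)) (U : R -> int -> int -> 'cV[R]_6),
        open J -> solution g dx dy avgx avgy k J G U ->
        forall (t : R) (i j : int), J t -> G (i, j) ->
          let qx_ := at_interface qhx (fun i' => U t i' j) in
          let qy_ := at_interface qhy (fun j' => U t i j') in
          derivable (fun s => entropy (U s i j)) t 1 /\
          derive1 (fun s => entropy (U s i j)) t
            + dx^-1 * (qx_ i - qx_ (i - 1))
            + dy^-1 * (qy_ j - qy_ (j - 1)) <= 0].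
Proof.
pose psix (U : 'cV[R]_6) := 2 * depth (primitive U) * vel1 (primitive U).
pose psiy (U : 'cV[R]_6) := 2 * depth (primitive U) * vel2 (primitive U).
exists (window_eflux (@ec_x R) (@Rtilde_x R) (@eigenvalues_x R) avgx psix k).
exists (window_eflux (@ec_y R) (@Rtilde_y R) (@eigenvalues_y R) avgy psiy k).
split.
- apply: es_eflux_consistent => // U Uadm.
  rewrite -ec_x_consistent// /two_point_eflux entropy_varE// dotDl /psix; lra.
- apply: es_eflux_consistent => // U Uadm.
  rewrite -ec_y_consistent// /two_point_eflux entropy_varE// dotDl /psiy; lra.
move=> J G U _ sol t i j Jt Gij qx_ qy_.
have [adm /(_ i j Gij)[dU scheme]] := sol t Jt.
have [dent entE] := is_derive_entropy (fun s => U s i j) t dU (adm i j).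
split=> //; rewrite derive1E entE -entropy_varE//.
have xstable : qx_ i - qx_ (i - 1) <= dot (entropy_var (U t i j))
    (es_flux_x avgx k (fun a => U t a j) i - es_flux_x avgx k (fun a => U t a j) (i - 1)).
  rewrite /qx_ !at_interfaceE//.
  apply: (es_eflux_stable _ _ _ _ _ _ _ _ _ (fun a => U t a j)) => //.
  + by move=> A B Aadm Badm; rewrite !entropy_varE//; exact: ec_x_conservative.
  + exact: Rtilde_x_unit.
have ystable : qy_ j - qy_ (j - 1) <= dot (entropy_var (U t i j))
    (es_flux_y avgy k (fun b => U t i b) j - es_flux_y avgy k (fun b => U t i b) (j - 1)).
  clear xstable; rewrite /qy_ !at_interfaceE//.
  apply: (es_eflux_stable _ _ _ _ _ _ _ _ _ (fun b => U t i b)) => //.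
  + by move=> A B Aadm Badm; rewrite !entropy_varE//; exact: ec_y_conservative.
  + exact: Rtilde_y_unit.
rewrite derive1E in scheme.
apply: (entropy_decay _ _ _ _ _ _ _ _ _ _ _ _ _ _ hdx hdy _ _ xstable ystable scheme).
- by rewrite entropy_varE// dot_entropy_var_Bx.
- by rewrite entropy_varE// dot_entropy_var_By.
Qed.
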